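(* Let $p\in(0,1)$ and for each $n$ let $A$ be the adjacency matrix of an Erdős–Rényi graph on $n$ vertices with edge probability $p$. Let $\hat\lambda$ be the largest eigenvalue of $A$, $\hat V$ an associated unit eigenvector and $\hat X=\hat\lambda^{1/2}\hat V$. Then for each fixed index $i$, as $n\to\infty$, $$\sqrt n\,(\hat X_i-\sqrt p)\stackrel{\mathcal L}{\longrightarrow}\mathcal N(0,1-p).$$
   Context: The graph is undirected and loop-free: $A$ is symmetric with zero diagonal and the entries $A_{ij}$, $i<j$, are i.i.d. $\mathrm{Bernoulli}(p)$. The sign of $\hat V$ is chosen so that the sum of its entries is nonnegative. *)

(* Defs.v *)
From HB Require Import structures.
From mathcomp Require Export all_boot all_order all_algebra.
From mathcomp Require Export all_classical all_reals all_analysis.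
Set Implicit Arguments.
Unset Strict Implicit.
Unset Printing Implicit Defensive.
Export Order.TTheory GRing.Theory Num.Theory.
Export numFieldNormedType.Exports.

Local Open Scope classical_set_scope.
Local Open Scope ring_scope.

(* The product rule is required for every finite subfamily of (X k)_(k in D). *)
Definition mutually_independent (d d' : measure_display)
    (T : measurableType d) (T' : measurableType d') (R : realType)
    (P : probability T R) (I : finType) (D : {pred I})
    (X : I -> {RV P >-> T'}) : Prop :=
  forall (J : {set I}) (B : I -> set T'),
    {subset J <= D} -> (forall k, measurable (B k)) ->
    P [set w | forall k, k \in J -> B k (X k w)] =
    (\prod_(k in J) P (X k @^-1` B k))%E.

(* [E i j w] says that vertices i and j are adjacent at the outcome w. *)
Definition erdos_renyi (d : measure_display) (T : measurableType d)
    (R : realType) (P : probability T R) (p : R) (n : nat)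
    (E : 'I_n -> 'I_n -> {RV P >-> bool}) : Prop :=
  [/\ forall i w, E i i w = false,
      forall i j w, E i j w = E j i w,
      forall i j : 'I_n, (i < j)%N ->
        distribution P (E i j) = bernoulli_prob p :> (set bool -> \bar R)
    & mutually_independent [pred ij : 'I_n * 'I_n | (ij.1 < ij.2)%N]
        (fun ij => E ij.1 ij.2)].

Definition adjacency_matrix (d : measure_display) (T : measurableType d)
    (R : realType) (P : probability T R) (n : nat)
    (E : 'I_n -> 'I_n -> {RV P >-> bool}) (w : T) : 'M[R]_n :=
  \matrix_(i, j) (E i j w)%:R.

Definition largest_eigenvalue (R : realType) (n : nat) (A : 'M[R]_n)
    (a : R) : Prop :=
  eigenvalue A a /\ forall b, eigenvalue A b -> b <= a.

(* The library norm of a matrix is the sup norm, hence the explicit Euclidean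
   normalization. *)
Definition unit_eigenvector (R : realType) (n : nat) (A : 'M[R]_n) (a : R)
    (v : 'cV[R]_n) : Prop :=
  A *m v = a *: v /\ \sum_i v i 0 ^+ 2 = 1.

(* Convergence in distribution of real random variables, each of which may
   live on its own probability space: pointwise convergence of the
   distribution functions at the continuity points of the limit one. *)
Definition cvg_in_law (R : realType) (d : nat -> measure_display)
    (T : forall n, measurableType (d n)) (P : forall n, probability (T n) R)
    (Y : forall n, T n -> R) (nu : probability (measurableTypeR R) R) : Prop :=
  (forall n, measurable_fun setT (Y n)) /\
  forall x : R, {for x, continuous (fun t : R => nu `]-oo, t]%classic)} ->
    P n (Y n @^-1` `]-oo, x]%classic) @[n --> \oo] --> nu `]-oo, x]%classic.

(* Main.v *)
From HB Require Import structures.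
Require Import Defs.
From mathcomp Require Import ring lra zify measurable_realfun.

(* Write A = p (J - 1) + W with W symmetric and centered, N for the number of
   vertices, u for the normalized all-one vector and g = W u.  The eigenvalue
   equation reads (lambda + p) v = p N <u, v> u + W v.  Once the operator norm
   of W is O(N^(3/4)), |g| = O(sqrt N) and <u, g> = O(1), it forces
   |v - <u, v> u| = O(N^(-1/2)) and lambda = p N + O(1); solving it once more
   for the i-th coordinate, and using that (W g)_i = O(sqrt N), gives
   sqrt N (X_i - sqrt p) = g_i / sqrt p + O(N^(-1/4)).
   The bounds on W hold with probability close to 1 by Markov's inequality
   applied to second moments, the operator norm of W being controlled by the
   Frobenius norm of W^2.  Finally g_i is a normalized sum of independent
   centered Bernoulli variables: its convergence to N(0, p (1 - p)) follows by
   replacing the summands one at a time, testing against Gaussian distribution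
   functions of positive variance, which solve the heat equation. *)

Set Implicit Arguments.
Unset Strict Implicit.
Unset Printing Implicit Defensive.

Local Open Scope ring_scope.

(** * The Gaussian distribution function *)

Section mean_value.
Local Open Scope classical_set_scope.

(** The Frobenius norm of [W] itself has order N, comparable with the main eigenvalue p N, and gives
    no spectral gap; that of [W^2] has order N^(3/2), whence the exponent 3/4, which is enough. The
    obstacle is the term [(W r)_i] with [r = v - <u, v> u]. It has to be o(1), whereas the norm
    bounds give only N^(3/4) N^(-1/2), and even an operator norm of order sqrt N would give O(1),
    the size of [g_i] itself. As [r] depends on all of [W], no moment of [(W r)_i] is computed:
    substituting the eigenvalue equation for [r] once more gains a division by [lambda + p], after
    which crude bounds suffice. Gaussian distribution functions are the test functions because the
    family is stable: averaging out one summand returns, up to a cubic error, a member of the same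
    family with a larger variance. *)

Lemma mean_value_bound (R : realType) (f df : R -> R) (M a b : R) :
  a <= b -> (forall x : R, is_derive x 1 f (df x)) ->
  (forall x, a <= x <= b -> `|df x| <= M) -> `|f b - f a| <= M * (b - a).
Proof.
move=> ab dfE dfM.
have cf : {within `[a, b], continuous f}.
  by apply: derivable_within_continuous => x _; have [] := dfE x.
have [c] := MVT_segment ab (fun x _ => dfE x) cf.
rewrite in_itv/= => cab ->; rewrite normrM (ger0_norm (_ : 0 <= b - a)) ?subr_ge0//.
by rewrite ler_wpM2r ?subr_ge0// dfM.
Qed.

Lemma lipschitz_of_derive (R : realType) (f df : R -> R) (M a b : R) :
  (forall x : R, is_derive x 1 f (df x)) ->
  (forall x, `|df x| <= M) -> `|f b - f a| <= M * `|b - a|.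
Proof.
move=> dfE dfM; have [ab|/ltW ba] := leP a b.
  rewrite (ger0_norm (_ : 0 <= b - a)) ?subr_ge0//.
  by apply: mean_value_bound dfE _ => // x _.
rewrite distrC (distrC b) (ger0_norm (_ : 0 <= a - b)) ?subr_ge0//.
by apply: mean_value_bound dfE _ => // x _.
Qed.

End mean_value.

Section gauss_cdf.
Local Open Scope classical_set_scope.
Context {R : realType}.

Definition normal_cdf (s x : R) : R := fine (normal_prob 0 s `]-oo, x]%classic : \bar R).

Lemma is_derive_normal_cdf (s x : R) : s != 0 ->
  is_derive x 1 (normal_cdf s) (normal_pdf 0 s x).
Proof.
move=> s0; have xx1 : x < x + 1 by rewrite ltrDl.
have ig : lebesgue_measure.-integrable `]-oo, (x + 1)]%classic
    (EFin \o (normal_pdf 0 s : R -> R)).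
  exact: integrableS (integrable_normal_pdf 0 s).
have cg : {for x, continuous (normal_pdf 0 s : R -> R)} by exact: continuous_normal_pdf.
have [df dfE] := continuous_FTC1 xx1 ig (ltNyr _) cg.
rewrite (_ : normal_cdf s =
  fun y => \int[lebesgue_measure]_(t in [set` `]-oo, y]]) normal_pdf 0 s t)%R//.
by apply: DeriveDef; [exact: df|rewrite -derive1E dfE].
Qed.

Definition gauss_pdf (x : R) : R := normal_pdf 0 1 x.

Definition gauss_cdf (x : R) : R := normal_cdf 1 x.

Lemma gauss_pdfE x : gauss_pdf x = normal_peak 1 * expR (- (x ^+ 2 / 2)).
Proof.
rewrite /gauss_pdf normal_pdfE// /normal_fun subr0 expr1n mulNr; congr (_ * expR (- (_ / _))).
Qed.

Lemma is_derive_gauss_cdf (x : R) : is_derive x 1 gauss_cdf (gauss_pdf x).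
Proof. exact/is_derive_normal_cdf/oner_neq0. Qed.

Lemma is_derive_gauss_pdf (x : R) : is_derive x 1 gauss_pdf (- x * gauss_pdf x).
Proof.
have -> : gauss_pdf = (fun x => normal_peak 1 * expR (- (x ^+ 2 / 2))).
  by apply/funext => y; rewrite gauss_pdfE.
by apply: is_derive_eq; rewrite /GRing.scale/=; field.
Qed.

Lemma gauss_cdf_ge0 x : 0 <= gauss_cdf x.
Proof. exact: fine_ge0. Qed.

Lemma gauss_cdf_le1 x : gauss_cdf x <= 1.
Proof.
rewrite -lee_fin fineK ?fin_num_measure//; exact: probability_le1.
Qed.

Lemma gauss_cdf_le : {homo gauss_cdf : x y / x <= y}.
Proof.
move=> x y xy; rewrite fine_le ?fin_num_measure//.
by apply: le_measure; rewrite ?inE//; apply: subset_itvl; rewrite bnd_simp.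
Qed.

Lemma continuous_gauss_cdf : continuous gauss_cdf.
Proof.
move=> x; apply/differentiable_continuous/derivable1_diffP.
by have [] := is_derive_gauss_cdf x.
Qed.

End gauss_cdf.

Section normal_cdf.
Local Open Scope classical_set_scope.
Context {R : realType}.
Implicit Types (s x : R).

Let idTR : measurableTypeR R -> R := idfun.

#[local] HB.instance Definition _ :=
  @isMeasurableFun.Build _ _ _ _ idTR (@measurable_id _ _ setT).

Lemma normal_cdf_cvg s :
  normal_cdf s x @[x --> -oo] --> (0 : R) /\ normal_cdf s x @[x --> +oo] --> (1 : R).
Proof.
pose P : probability (measurableTypeR R) R := normal_prob 0 s.
pose X : {RV P >-> R} := idTR.
by split; apply: fine_cvg; [exact: (cvg_cdfNy0 X)|exact: (cvg_cdfy1 X)].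
Qed.

(** Both sides have the same derivative, so their difference is constant; it tends to 0 at [-oo]. *)
Lemma normal_cdf_scale s x : 0 < s -> normal_cdf s x = gauss_cdf (x / s).
Proof.
move=> s0; have sn0 : s != 0 by rewrite gt_eqF.
pose D y := normal_cdf s y - gauss_cdf (y / s).
have dD (y : R) : is_derive y 1 D 0.
  have ? := is_derive_normal_cdf y sn0.
  have ? := @is_derive_gauss_cdf R.
  have ? : is_derive y 1 (fun y => y / s) s^-1.
    by apply: is_derive_eq; rewrite /GRing.scale/=; ring.
  have ? := @is_derive1_comp _ gauss_cdf (fun y => y / s) y _ _ _ _.
  have -> : D = (fun y => normal_cdf s y - (gauss_cdf \o (fun y => y / s)) y) by [].
  apply: is_derive_eq; rewrite gauss_pdfE normal_pdfE// /normal_fun subr0.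
  apply/eqP; rewrite subr_eq0; apply/eqP.
  rewrite mulrAC; congr (_ * _); last by congr expR; field.
  by rewrite /normal_peak expr1n mul1r -mulrnAr sqrtrM ?sqr_ge0// sqrtr_sqr gtr0_norm//
    invfM mulrC.
apply/eqP; rewrite -subr_eq0 -/(D x); apply/eqP.
have D0 : D y @[y --> -oo] --> (0 : R).
  rewrite -[X in _ --> X](subr0 0); apply: cvgB; first by have [] := normal_cdf_cvg s.
  have [c _] := normal_cdf_cvg 1.
  apply: cvg_comp c.
  apply/gt0_cvgMlNy; [by rewrite invr_gt0|exact: cvg_id].
have : D y @[y --> -oo] --> D x.
  rewrite (_ : D = cst (D x)); first exact: cvg_cst.
  by apply/funext => y; exact: is_derive_0_is_cst.
by move=> DDx; exact: (cvg_unique _ DDx D0).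
Qed.

Lemma gauss_cdf_tails (eta : R) : 0 < eta ->
  exists2 M : R, 0 < M & gauss_cdf (- M) <= eta /\ 1 - eta <= gauss_cdf M.
Proof.
move=> eta0; have [cN cy] := normal_cdf_cvg 1.
have [A [_ hA]] : \forall y \near -oo, gauss_cdf y <= eta.
  move/cvgrPdist_le : cN => /(_ _ eta0); apply: filterS => y.
  by rewrite sub0r normrN => /ler_normlW.
have [B [_ hB]] : \forall y \near +oo, 1 - eta <= gauss_cdf y.
  move/cvgrPdist_le : cy => /(_ _ eta0); apply: filterS => y /ler_normlW.
  by rewrite lerBlDr addrC -lerBlDr.
exists (1 + `|A| + `|B|); first by rewrite !ltr_wpDr.
split; [apply: hA|apply: hB].
  have := ler_norm (- A); rewrite normrN; have := normr_ge0 B; lra.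
have := ler_norm B; have := normr_ge0 A; lra.
Qed.

End normal_cdf.

(** * One Bernoulli step of the heat equation *)

Section heat.
Local Open Scope classical_set_scope.
Context {R : realType}.
Implicit Types x y s e p : R.

Lemma gauss_pdf_ge0 x : 0 <= gauss_pdf x.
Proof. exact: normal_pdf_ge0. Qed.

(** With [w = exp (z^2 / 4) >= 1 + z^2 / 4] the exponential factor is [w^-2], and the quartic
    [(1 + z^2 / 4)^2] dominates every cubic. Degree three is what the derivative estimates of the
    heat step require. *)
Lemma gauss_pdf_decay : exists2 C : R, 0 <= C &
  forall x, (1 + `|x| + `|x| ^+ 2 + `|x| ^+ 3) * gauss_pdf x <= C.
Proof.
exists (16 * normal_peak 1); first by rewrite mulr_ge0// normal_peak_ge0.
move=> x; rewrite gauss_pdfE mulrCA [leRHS]mulrC ler_wpM2l ?normal_peak_ge0//.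
rewrite -(real_normK (num_real x)); set z := `|x|.
have z0 : 0 <= z by exact: normr_ge0.
have := expR_ge1Dx (z ^+ 2 / 4); set w := expR _ => wge.
have -> : expR (- (z ^+ 2 / 2)) = (w ^+ 2)^-1.
  by rewrite expRN /w -expRM_natl; congr (expR _)^-1; field.
have w1 : 1 <= w by apply: le_trans wge; rewrite lerDl; nra.
rewrite ler_pdivrMr; last by nra.
have : (1 + z ^+ 2 / 4) ^+ 2 <= w ^+ 2.
  by rewrite lerXn2r// nnegrE; nra.
suff : 1 + z + z ^+ 2 + z ^+ 3 <= 16 * (1 + z ^+ 2 / 4) ^+ 2 by lra.
by nra.
Qed.

Definition gauss_pdf' x : R := - x * gauss_pdf x.

Lemma is_derive_gauss_pdf' x :
  is_derive x 1 gauss_pdf' ((x ^+ 2 - 1) * gauss_pdf x).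
Proof.
have := is_derive_gauss_pdf x => ?.
apply: is_derive_eq; rewrite /GRing.scale/=; ring.
Qed.

(* Since [gauss_cdf (x / sqrt s)] solves [2 d/ds = d^2/dx^2], a centered
   Bernoulli step of size [y] agrees with an increase of the variance [s] by
   [p (1 - p) y^2], up to [O(y^3)].  Only first derivatives in [y] are
   estimated. *)
Lemma gauss_heat_step p e : 0 <= p <= 1 -> 0 < e ->
  exists2 C : R, 0 <= C & forall s x y, e ^+ 2 <= s -> 0 <= y ->
  `|p * gauss_cdf ((x - (1 - p) * y) / Num.sqrt s)
    + (1 - p) * gauss_cdf ((x + p * y) / Num.sqrt s)
    - gauss_cdf (x / Num.sqrt (s + p * (1 - p) * y ^+ 2))| <= C * y ^+ 3.
Proof.
move=> /andP[p0 p1] e0; have [K K0 decay] := gauss_pdf_decay.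
exists (4 * K * e^-1 ^+ 3) => [|s x y0 es y00].
  by apply: mulr_ge0; [exact: mulr_ge0|apply: exprn_ge0; rewrite invr_ge0 ltW].
have s0 : 0 < s by apply: lt_le_trans es; rewrite exprn_gt0.
set q := 1 - p; have q0 : 0 <= q by rewrite /q; lra.
have pq1 : p * q <= 1 by rewrite /q; nra.
have pq0 : 0 <= p * q by rewrite mulr_ge0.
pose sy y := s + p * q * y ^+ 2; pose t y := (Num.sqrt (sy y))^-1.
have sy0 y : 0 < sy y by rewrite ltr_wpDr// mulr_ge0// sqr_ge0.
have t0 y : 0 < t y by rewrite invr_gt0 sqrtr_gt0.
set t0' := (Num.sqrt s)^-1.
have t0'0 : 0 < t0' by rewrite invr_gt0 sqrtr_gt0.
have t0'e : t0' <= e^-1.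
  by rewrite lef_pV2 ?posrE ?sqrtr_gt0// -(ger0_norm (ltW e0)) -sqrtr_sqr ler_wsqrtr.
have dt y : is_derive y 1 t (- (p * q * y * t y ^+ 3)).
  have ? : is_derive y 1 sy (p * q * (2 * y)).
    by apply: is_derive_eq; rewrite /GRing.scale/=; ring.
  have ? := is_derive1_sqrt (sy0 y).
  have ? : is_derive y 1 (Num.sqrt \o sy) ((2 * Num.sqrt (sy y))^-1 * (p * q * (2 * y))).
    exact: is_derive1_comp.
  have nz : (Num.sqrt \o sy) y != 0 by rewrite /= gt_eqF// sqrtr_gt0.
  have -> : t = (fun y => ((Num.sqrt \o sy) y)^-1) by [].
  have ? := is_deriveV nz; apply: is_derive_eq.
  rewrite /GRing.scale/=; field.
  by rewrite gt_eqF// sqrtr_gt0.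
have tt0 y : 0 <= y -> t y <= t0' /\ t0' - t y <= t0' ^+ 2 * y.
  move=> yge0; rewrite /t /t0'; set a := Num.sqrt s; set b := Num.sqrt _.
  have a0 : 0 < a by rewrite sqrtr_gt0.
  have b0 : 0 < b by rewrite sqrtr_gt0.
  have a2 : a ^+ 2 = s by rewrite sqr_sqrtr// ltW.
  have b2 : b ^+ 2 = sy y by rewrite sqr_sqrtr// ltW.
  have ab : a <= b by rewrite ler_wsqrtr// /sy lerDl mulr_ge0// sqr_ge0.
  have bay : b <= a + y.
    rewrite -(@ler_pXn2r _ 2)// ?nnegrE ?addr_ge0 ?(ltW a0) ?(ltW b0)//.
    rewrite b2 /sy -a2; have : 0 <= a * y by rewrite mulr_ge0// ltW.
    have : p * q * y ^+ 2 <= y ^+ 2 by rewrite ler_piMl// sqr_ge0.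
    by rewrite sqrrD mulr2n; lra.
  split; first by rewrite lef_pV2.
  have -> : a^-1 - b^-1 = (b - a) / (a * b) by field; rewrite !gt_eqF.
  rewrite ler_pdivrMr ?mulr_gt0//.
  have -> : a^-1 ^+ 2 * y * (a * b) = y * (b / a) by field; rewrite gt_eqF.
  apply: (@le_trans _ _ y); first lra.
  by rewrite ler_peMr// ler_pdivlMr// mul1r.
pose D y := p * gauss_cdf ((x - q * y) * t0') + q * gauss_cdf ((x + p * y) * t0')
   - gauss_cdf (x * t y).
(* As the step is centered, the two jump terms combine into a difference of densities at points
   [y * t0'] apart. The variance term cancels its leading part, so [D'] is O(y^2), and integrating
   from [D 0 = 0] gives the cubic bound. *)
pose D' y := p * q * (t0' * (gauss_pdf ((x + p * y) * t0') -
   gauss_pdf ((x - q * y) * t0')) - y * (t y ^+ 2 * gauss_pdf' (x * t y))).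
have dD y : is_derive y 1 D (D' y).
  have dlin (a b : R) : is_derive y 1 (fun y => gauss_cdf ((x + a * y) * b))
      (gauss_pdf ((x + a * y) * b) * (a * b)).
    have ? := @is_derive_gauss_cdf R.
    have ? : is_derive y 1 (fun y => (x + a * y) * b) (a * b).
      by apply: is_derive_eq; rewrite /GRing.scale/=; ring.
    exact: (@is_derive1_comp _ gauss_cdf (fun y => (x + a * y) * b)).
  have ? := dlin (- q) t0'; have ? := dlin p t0'.
  have ? : is_derive y 1 (fun y => gauss_cdf (x * t y))
      (gauss_pdf (x * t y) * (x * - (p * q * y * t y ^+ 3))).
    have ? := @is_derive_gauss_cdf R; have ? := dt y.
    have ? : is_derive y 1 (fun y => x * t y) (x * - (p * q * y * t y ^+ 3)).
      by apply: is_derive_eq; rewrite /GRing.scale/=; ring.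
    exact: (@is_derive1_comp _ gauss_cdf (fun y => x * t y)).
  have -> : D = (fun y => p * gauss_cdf ((x + - q * y) * t0')
      + q * gauss_cdf ((x + p * y) * t0') - gauss_cdf (x * t y)).
    by apply/funext => z; rewrite /D mulNr.
  apply: is_derive_eq; rewrite /GRing.scale/= /D' /gauss_pdf' mulNr; ring.
have absE (z : R) : 0 <= `|z| by exact: normr_ge0.
have b1 (z : R) : `|gauss_pdf' z| <= K.
  rewrite normrM normrN (ger0_norm (gauss_pdf_ge0 _)); apply: le_trans (decay z).
  by rewrite ler_wpM2r ?gauss_pdf_ge0//; have := absE z; nra.
have b2 (z : R) : `|(z ^+ 2 - 1) * gauss_pdf z| <= K.
  rewrite normrM (ger0_norm (gauss_pdf_ge0 _)); apply: le_trans (decay z).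
  rewrite ler_wpM2r ?gauss_pdf_ge0//; apply: le_trans (ler_normB _ _) _.
  by rewrite normr1 normrX; have := absE z; nra.
have b3 (z : R) : `|z * ((z ^+ 2 - 1) * gauss_pdf z)| <= K.
  rewrite mulrA normrM (ger0_norm (gauss_pdf_ge0 _)); apply: le_trans (decay z).
  rewrite ler_wpM2r ?gauss_pdf_ge0// normrM.
  have : `|z ^+ 2 - 1| <= `|z| ^+ 2 + 1.
    by apply: le_trans (ler_normB _ _) _; rewrite normr1 normrX.
  by have := absE z; nra.
have D'b y : 0 <= y -> `|D' y| <= 4 * K * t0' ^+ 3 * y ^+ 2.
  move=> yge0; have [tyle tydist] := tt0 y yge0.
  have [c c1 c2] : exists2 c, (x - q * y) * t0' <= c <= (x + p * y) * t0' &
      gauss_pdf ((x + p * y) * t0') - gauss_pdf ((x - q * y) * t0') =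
      gauss_pdf' c * (y * t0').
    have le1 : (x - q * y) * t0' <= (x + p * y) * t0'.
      rewrite ler_wpM2r ?(ltW t0'0)// lerD2l.
      by apply: (@le_trans _ _ 0); rewrite ?oppr_le0 mulr_ge0.
    have cf : {within `[(x - q * y) * t0', (x + p * y) * t0'], continuous (@gauss_pdf R)}.
      apply: derivable_within_continuous => z _.
      by have [] := is_derive_gauss_pdf z.
    have [c] := MVT_segment le1 (fun z _ => is_derive_gauss_pdf z) cf.
    rewrite in_itv/= => cab ->; exists c => //; rewrite /gauss_pdf' /q; ring.
  have c3 : `|gauss_pdf' c - gauss_pdf' (x * t0')| <= K * (y * t0').
    apply: le_trans (lipschitz_of_derive _ _ is_derive_gauss_pdf' b2) _.
    by rewrite ler_wpM2l// ler_norml; move: c1; rewrite /q; nra.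
  have c4 : `|t0' ^+ 2 * gauss_pdf' (x * t0') - t y ^+ 2 * gauss_pdf' (x * t y)|
      <= 3 * K * t0' * (t0' - t y).
    (* The bound must be uniform in [x]. The derivative of [h] contains [x] only through the product
       [x * u], whose powers are absorbed by the Gaussian decay; the constant 3 is 2 from [b1] plus
       1 from [b3]. *)
    pose h u := u ^+ 2 * gauss_pdf' (x * u).
    have dh (u : R) : is_derive u 1 h (u * (2 * gauss_pdf' (x * u) +
        (x * u) * (((x * u) ^+ 2 - 1) * gauss_pdf (x * u)))).
      have ? := is_derive_gauss_pdf'.
      have ? : is_derive u 1 (fun u => x * u) x.
        by apply: is_derive_eq; rewrite /GRing.scale/=; ring.
      have ? := @is_derive1_comp _ gauss_pdf' (fun u => x * u) u _ _ _ _.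
      have -> : h = (fun u => u ^+ 2 * (gauss_pdf' \o (fun u => x * u)) u) by [].
      apply: is_derive_eq; rewrite /GRing.scale/=; ring.
    apply: (mean_value_bound tyle dh) => u /andP[u1 u2].
    have u0 : 0 <= u by apply: le_trans u1; exact: ltW.
    rewrite normrM (ger0_norm u0) [leRHS]mulrC.
    apply: ler_pM => //; apply: le_trans (ler_normD _ _) _.
    rewrite [X in X + _ <= _]normrM (ger0_norm (_ : 0 <= 2 :> R))//.
    by have := b1 (x * u); have := b3 (x * u); lra.
  rewrite /D' c2 normrM (ger0_norm pq0).
  have -> : t0' * (gauss_pdf' c * (y * t0')) - y * (t y ^+ 2 * gauss_pdf' (x * t y)) =
     y * (t0' ^+ 2 * (gauss_pdf' c - gauss_pdf' (x * t0')) +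
      (t0' ^+ 2 * gauss_pdf' (x * t0') - t y ^+ 2 * gauss_pdf' (x * t y))) by ring.
  rewrite normrM (ger0_norm yge0).
  have c5 : `|t0' ^+ 2 * (gauss_pdf' c - gauss_pdf' (x * t0')) +
      (t0' ^+ 2 * gauss_pdf' (x * t0') - t y ^+ 2 * gauss_pdf' (x * t y))|
      <= 4 * K * t0' ^+ 3 * y.
    apply: le_trans (ler_normD _ _) _; rewrite normrM (ger0_norm (sqr_ge0 _)).
    have : t0' ^+ 2 * `|gauss_pdf' c - gauss_pdf' (x * t0')| <= t0' ^+ 2 * (K * (y * t0')).
      by rewrite ler_wpM2l// sqr_ge0.
    have : 3 * K * t0' * (t0' - t y) <= 3 * K * t0' * (t0' ^+ 2 * y).
      by rewrite ler_wpM2l// !mulr_ge0// ltW.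
    by move: c4; set X := `| _ - _ * gauss_pdf' (x * t y) |; lra.
  apply: (@le_trans _ _ (y * (4 * K * t0' ^+ 3 * y))); last by lra.
  apply: le_trans (ler_piMl _ pq1) _; first by rewrite mulr_ge0 ?normr_ge0.
  by rewrite ler_wpM2l.
have := mean_value_bound y00 dD; rewrite subr0.
have -> : D 0 = 0.
  rewrite /D /t /sy !mulr0 subr0 addr0 expr0n/= mulr0 addr0 -/t0' /q; ring.
rewrite subr0 => /(_ (4 * K * t0' ^+ 3 * y0 ^+ 2)) H.
apply: le_trans (H _) _.
  move=> y /andP[y1 y2]; apply: le_trans (D'b y y1) _.
  rewrite ler_wpM2l ?mulr_ge0 ?exprn_ge0 ?(ltW t0'0)//.
  by rewrite lerXn2r// nnegrE.
have te3 : t0' ^+ 3 <= e^-1 ^+ 3.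
  by rewrite lerXn2r// nnegrE ltW// invr_gt0.
have : 4 * K * y0 ^+ 3 * t0' ^+ 3 <= 4 * K * y0 ^+ 3 * e^-1 ^+ 3.
  by rewrite ler_wpM2l// mulr_ge0 ?exprn_ge0// mulr_ge0.
by lra.
Qed.

End heat.

(** * Random subsets with independent elements *)

Section random_subset.
Context {R : realType} {I : finType} (p : R) (D : {set I}).
Implicit Types (A : {set I}) (f h : {set I} -> R) (e : I).

(* [expect f] is the expectation of [f A] for the random subset [A] of [D] that
   contains each element of [D] independently with probability [p]. *)
Definition subset_weight A : R := \prod_(e in D) (if e \in A then p else 1 - p).

Definition expect f : R := \sum_(A in powerset D) f A * subset_weight A.

Lemma eq_expect f h : f =1 h -> expect f = expect h.
Proof. by move=> fh; apply: eq_bigr => A _; rewrite fh. Qed.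

Lemma expectD f h : expect (fun A => f A + h A) = expect f + expect h.
Proof. by rewrite -big_split; apply: eq_bigr => A _; rewrite mulrDl. Qed.

Lemma expectZ c f : expect (fun A => c * f A) = c * expect f.
Proof. by rewrite [RHS]mulr_sumr; apply: eq_bigr => A _; rewrite mulrA. Qed.

Lemma expectB f h : expect (fun A => f A - h A) = expect f - expect h.
Proof.
rewrite -[X in _ = _ + X]mulN1r -expectZ -expectD.
by apply: eq_expect => A; rewrite mulN1r.
Qed.

Lemma expect_sum (J : Type) (r : seq J) (P : pred J) (F : J -> {set I} -> R) :
  expect (fun A => \sum_(j <- r | P j) F j A) = \sum_(j <- r | P j) expect (F j).
Proof.
rewrite [RHS]exchange_big; apply: eq_bigr => A _; by rewrite mulr_suml.
Qed.

(** Averaging over the membership of [e] alone: every set without [e] is paired with the set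
    obtained by adding it. Both sides are expectations over subsets of the same [D], so inductions
    never change the ground set. *)
Lemma expect_split f e : e \in D ->
  expect f = expect (fun A => p * f (e |: A) + (1 - p) * f (A :\ e)).
Proof.
move=> eD.
have pair h : expect h = \sum_(A in powerset D | e \notin A)
    (p * h (e |: A) + (1 - p) * h A) * \prod_(e' in D :\ e) (if e' \in A then p else 1 - p).
  rewrite /expect (bigID [pred A : {set I} | e \in A])/=.
  rewrite (reindex_onto (fun A => e |: A) (fun A => A :\ e))/=; last first.
    by move=> A /andP[_ eA]; rewrite finset.setD1K.
  rewrite (eq_bigl (fun A => (A \in powerset D) && (e \notin A))); last first.
    move=> A /=; rewrite !inE eqxx/= andbT finset.subUset finset.sub1set eD/=.
    have [AD|//] := boolP (A \subset D); rewrite /=.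
    apply/eqP/idP => [<-|eA]; first by rewrite !inE eqxx.
    by rewrite setU1K.
  rewrite -big_split; apply: eq_bigr => A /andP[_ eA].
  rewrite /subset_weight (big_setD1 e eD)/= [in X in _ + X](big_setD1 e eD)/=.
  rewrite !inE eqxx (negbTE eA)/=.
  have -> : \prod_(i in D :\ e) (if i \in e |: A then p else 1 - p) =
      \prod_(i in D :\ e) (if i \in A then p else 1 - p).
    by apply: eq_bigr => e' /setD1P[e'e _]; rewrite !inE (negbTE e'e).
  ring.
rewrite [LHS]pair [RHS]pair; apply: eq_bigr => A /andP[_ eA]; congr (_ * _).
have -> : (e |: A) :\ e = A by rewrite setU1K.
have -> : e |: (e |: A) = e |: A by rewrite finset.setUA finset.setUid.
have -> : A :\ e = A by apply/finset.setDidPl; rewrite disjoint_sym disjoints1.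
ring.
Qed.

(** The total weight is a product of factors [p + (1 - p)], expanded over all sets. Outside [D] the
    factor is written [0 + 1], which kills exactly the sets not contained in [D]. *)
Lemma expect_cst c : expect (fun=> c) = c.
Proof.
rewrite /expect -mulr_sumr -[RHS]mulr1; congr (_ * _).
transitivity (\prod_(e : I) ((if e \in D then p else 0) + (if e \in D then 1 - p else 1))).
  rewrite bigA_distr [RHS](bigID (fun A : {set I} => A \in powerset D))/=.
  rewrite [X in _ + X]big1 ?addr0 => [|A].
    apply: eq_bigr => A; rewrite inE => AD.
    rewrite /subset_weight [RHS](bigID (mem D))/= [X in _ = _ * X]big1 ?mulr1.
      by apply: eq_bigr => e ->.
    move=> e eD; rewrite (negbTE eD) ifF//.
    by apply/negP => /(fintype.subsetP AD); rewrite (negbTE eD).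
  rewrite inE => /fintype.subsetPn[e eA eD].
  by rewrite (bigD1 e)//= eA (negbTE eD) mul0r.
by rewrite big1// => e _; case: ifP => _; ring.
Qed.

Hypothesis p01 : 0 <= p <= 1.

Lemma subset_weight_ge0 A : 0 <= subset_weight A.
Proof.
by apply: prodr_ge0 => e _; case: ifP => _; case/andP : p01 => *; rewrite ?subr_ge0.
Qed.

Lemma expect_le f h : (forall A, f A <= h A) -> expect f <= expect h.
Proof.
by move=> fh; apply: ler_sum => A _; rewrite ler_wpM2r ?subset_weight_ge0.
Qed.

Lemma expect_norm f : `|expect f| <= expect (fun A => `|f A|).
Proof.
apply: le_trans (ler_norm_sum _ _ _) _; apply: ler_sum => A _.
by rewrite normrM (ger0_norm (subset_weight_ge0 _)).
Qed.

Lemma expect_dist f h c : (forall A, `|f A - h A| <= c) ->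
  `|expect f - expect h| <= c.
Proof.
move=> fh; rewrite -expectB; apply: le_trans (expect_norm _) _.
by rewrite -[leRHS]expect_cst; exact: expect_le.
Qed.

Lemma expect_markov f (c : R) : (forall A, 0 <= f A) -> 0 < c ->
  expect (fun A => (c <= f A)%R%:R) <= expect f / c.
Proof.
move=> f0 c0; rewrite ler_pdivlMr// mulrC -expectZ; apply: expect_le => A.
by have [cf|_] := boolP (c <= f A); rewrite ?mulr1 ?mulr0.
Qed.

Lemma expect_centered h e : e \in D -> (forall A, h (e |: A) = h (A :\ e)) ->
  expect (fun A => ((e \in A)%:R - p) * h A) = 0.
Proof.
move=> eD he; rewrite (expect_split _ eD) -[RHS](expect_cst 0).
by apply: eq_expect => A; rewrite he !inE eqxx /=; ring.
Qed.

(** Lindeberg replacement by induction on [l]. The head is averaged out first, which moves its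
    variance into [s] at cost [C]; the tail then starts from a larger [s]. This is why [s] varies in
    the induction and the one-step estimate is assumed for all [s >= eps]. *)
Lemma expect_gauss_cdf C eps y (l : seq I) (s a : R) :
  (forall s x, eps <= s ->
  `|p * gauss_cdf ((x - (1 - p) * y) / Num.sqrt s)
    + (1 - p) * gauss_cdf ((x + p * y) / Num.sqrt s)
    - gauss_cdf (x / Num.sqrt (s + p * (1 - p) * y ^+ 2))| <= C) ->
  uniq l -> {subset l <= D} -> eps <= s ->
  `|expect (fun A =>
      gauss_cdf ((a - y * \sum_(e <- l) ((e \in A)%:R - p)) / Num.sqrt s))
    - gauss_cdf (a / Num.sqrt (s + (size l)%:R * (p * (1 - p) * y ^+ 2)))|
  <= (size l)%:R * C.
Proof.
move=> hC; elim: l s => [|e l IH] s /=.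
  move=> _ _ _.
  under eq_expect do rewrite big_nil mulr0 subr0.
  by rewrite expect_cst !mul0r addr0 subrr normr0.
move=> /andP[el ul] elD es.
have eD : e \in D by apply: elD; rewrite inE eqxx.
have lD : {subset l <= D} by move=> k kl; apply: elD; rewrite inE kl orbT.
have v0 : 0 <= p * (1 - p) * y ^+ 2.
  by case/andP: p01 => *; rewrite mulr_ge0 ?sqr_ge0// mulr_ge0 ?subr_ge0.
have es' : eps <= s + p * (1 - p) * y ^+ 2 by rewrite (le_trans es)// lerDl.
have -> : s + (size l).+1%:R * (p * (1 - p) * y ^+ 2) =
  s + p * (1 - p) * y ^+ 2 + (size l)%:R * (p * (1 - p) * y ^+ 2).
  by rewrite -natr1; ring.
rewrite -natr1 mulrDl mul1r [leRHS]addrC.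
apply: le_trans (ler_distD _ _ _) (lerD _ (IH _ ul lD es')).
rewrite (expect_split _ eD); apply: expect_dist => A.
have sumE B : (forall e', e' != e -> (e' \in B) = (e' \in A)) ->
    \sum_(e' <- l) ((e' \in B)%:R - p) = \sum_(e' <- l) ((e' \in A)%:R - p).
  move=> BA; apply: eq_big_seq => e' el'; rewrite BA//.
  by apply: contraNneq el => <-.
have := hC s (a - y * \sum_(e' <- l) ((e' \in A)%:R - p)) es.
have sumU : \sum_(e' <- l) ((e' \in e |: A)%:R - p) = \sum_(e' <- l) ((e' \in A)%:R - p).
  by apply: sumE => e' e'e; rewrite !inE (negbTE e'e).
have sumD : \sum_(e' <- l) ((e' \in A :\ e)%:R - p) = \sum_(e' <- l) ((e' \in A)%:R - p).
  by apply: sumE => e' e'e; rewrite !inE e'e.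
rewrite !big_cons sumU sumD !inE eqxx /=.
set X := \sum_(_ <- _) _.
have -> : a - y * (1 - p + X) = a - y * X - (1 - p) * y by ring.
have -> : a - y * (0 - p + X) = a - y * X + p * y by ring.
by [].
Qed.

End random_subset.

(** * Moments of the centered adjacency matrix *)

Section centered_adjacency.
Context {R : realType} {N : nat} (p : R).
Implicit Types (A : {set 'I_N * 'I_N}) (i j k l : 'I_N) (e f : 'I_N * 'I_N).

Definition upper_pairs : {set 'I_N * 'I_N} := [set e : 'I_N * 'I_N | (e.1 < e.2)%N].

Definition edge_key i j : 'I_N * 'I_N := if (i < j)%N then (i, j) else (j, i).

Definition centered A : 'M[R]_N :=
  \matrix_(i, j) (if i == j then 0 else (edge_key i j \in A)%:R - p).

(** Equality of unordered pairs, stated on [nat] values so that the coincidence patterns in the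
    moment bounds fall to [lia]. *)
Definition same_edge e f :=
  [|| (e.1 == f.1 :> nat) && (e.2 == f.2 :> nat)
    | (e.1 == f.2 :> nat) && (e.2 == f.1 :> nat)].

Lemma edge_keyC i j : edge_key i j = edge_key j i.
Proof.
rewrite /edge_key; case: ltngtP => // ij; have -> // : i = j by exact: val_inj.
Qed.

Lemma edge_key_same i j k l : edge_key i j = edge_key k l -> same_edge (i, j) (k, l).
Proof.
rewrite /edge_key /same_edge /=.
by case: ifP => _; case: ifP => _ [-> ->]; rewrite !eqxx ?orbT.
Qed.

Lemma edge_key_upper i j : i != j -> edge_key i j \in upper_pairs.
Proof.
rewrite /edge_key -(inj_eq val_inj)/= => ij.
by rewrite inE; case: ifP => //=; lia.
Qed.

Lemma centeredC A i j : centered A i j = centered A j i.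
Proof. by rewrite !mxE edge_keyC eq_sym. Qed.

Lemma centered_change A i j k l : ~~ same_edge (i, j) (k, l) ->
  centered (edge_key i j |: A) k l = centered (A :\ edge_key i j) k l.
Proof.
move=> ijkl; rewrite !mxE; case: ifP => // _; rewrite !inE.
case: eqVneq => // /esym /edge_key_same; by rewrite (negbTE ijkl).
Qed.

Hypothesis p01 : 0 <= p <= 1.

Lemma centered_le1 A i j : `|centered A i j| <= 1.
Proof.
rewrite mxE; case: ifP => _; first by rewrite normr0.
case/andP: p01 => p0 p1.
by case: (_ \in A); rewrite ler_norml; apply/andP; split; rewrite /=; lra.
Qed.

Local Notation expect := (expect p upper_pairs).

Definition edge_product (r : seq ('I_N * 'I_N)) A : R :=
  \prod_(e <- r) centered A e.1 e.2.

(* The expectation of an edge product vanishes if some edge occurs only once in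
   it; the first alternative is a loop, on which [centered] itself is zero. *)
Definition isolated e r := (e.1 == e.2 :> nat) || ~~ has (same_edge e) r.

Lemma edge_product_le1 r A : edge_product r A <= 1.
Proof.
apply: le_trans (ler_norm _) _; rewrite normr_prod.
by apply: prodr_ile1 => e _; rewrite normr_ge0 centered_le1.
Qed.

Lemma expect_edge_product0 e r : isolated e r -> expect (edge_product (e :: r)) = 0.
Proof.
case: e => i j; rewrite /isolated /=; have [/val_inj ij _|ij /= er] := eqVneq.
  rewrite -[RHS](expect_cst p upper_pairs 0); apply: eq_expect => A.
  by rewrite /edge_product big_cons mxE ij eqxx mul0r.
have ij' : i != j by apply: contra_neq ij => ->.
rewrite -(@expect_centered _ _ p upper_pairs (edge_product r) _ (edge_key_upper ij')).
  by apply: eq_expect => A; rewrite /edge_product big_cons mxE (negbTE ij').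
move=> A; apply: eq_big_seq => -[k l] klr /=; apply: centered_change.
by apply: contra er => ?; apply/hasP; exists (k, l).
Qed.

(** Here [c] is any boolean that holds whenever no edge is isolated. A product with an isolated edge
    has mean zero and any other is at most 1, so each moment bound becomes a count of the index
    tuples satisfying [c]. *)
Lemma expect_edge_product r (c : bool) :
  (~~ c -> exists e r', perm_eq r (e :: r') && isolated e r') ->
  expect (edge_product r) <= c%:R.
Proof.
case: c => [_|/(_ isT)[e [r' /andP[er eiso]]]] /=.
  rewrite -(expect_cst p upper_pairs 1); apply: expect_le => // A.
  exact: edge_product_le1.
rewrite (_ : expect _ = expect (edge_product (e :: r'))).
  by rewrite expect_edge_product0.
by apply: eq_expect => A; exact: perm_big.
Qed.

Lemma expect_edge_product4 e1 e2 e3 e4 (c : bool) :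
  (~~ c -> [|| isolated e1 [:: e2; e3; e4], isolated e2 [:: e1; e3; e4],
    isolated e3 [:: e1; e2; e4] | isolated e4 [:: e1; e2; e3]]) ->
  expect (fun A => (centered A e1.1 e1.2 * centered A e2.1 e2.2) *
    (centered A e3.1 e3.2 * centered A e4.1 e4.2)) <= c%:R.
Proof.
move=> H; rewrite (_ : expect _ = expect (edge_product [:: e1; e2; e3; e4])).
  apply: expect_edge_product => /H /or4P[] iso.
  - by exists e1, [:: e2; e3; e4]; rewrite iso perm_refl.
  - exists e2, [:: e1; e3; e4]; rewrite iso andbT.
    by rewrite (perm_catCA [:: e1] [:: e2] [:: e3; e4]).
  - exists e3, [:: e1; e2; e4]; rewrite iso andbT.
    by rewrite (perm_catCA [:: e1; e2] [:: e3] [:: e4]).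
  - exists e4, [:: e1; e2; e3]; rewrite iso andbT.
    by rewrite (perm_catCA [:: e1; e2; e3] [:: e4] [::]).
by apply: eq_expect => A; rewrite /edge_product !big_cons big_nil; ring.
Qed.

Lemma expect_edge_product2 e1 e2 (c : bool) :
  (~~ c -> isolated e1 [:: e2]) ->
  expect (fun A => centered A e1.1 e1.2 * centered A e2.1 e2.2) <= c%:R.
Proof.
move=> H; rewrite (_ : expect _ = expect (edge_product [:: e1; e2])).
  by apply: expect_edge_product => /H iso; exists e1, [:: e2]; rewrite iso perm_refl.
by apply: eq_expect => A; rewrite /edge_product !big_cons big_nil; ring.
Qed.

Lemma sqr_sum (J : Type) (r : seq J) (F : J -> R) :
  (\sum_(j <- r) F j) ^+ 2 = \sum_(j <- r) \sum_(k <- r) F j * F k.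
Proof. by rewrite expr2 mulr_suml; apply: eq_bigr => j _; rewrite mulr_sumr. Qed.

Lemma sum_delta (F : 'I_N -> R) i : \sum_(j < N) (i == j :> nat)%:R * F j = F i.
Proof.
rewrite (bigD1 i)//= eqxx mul1r big1 ?addr0// => j ji.
by rewrite [_ == _ :> nat](_ : _ = (i == j))// eq_sym (negbTE ji) mul0r.
Qed.

Lemma sum_delta1 i : \sum_(j < N) (i == j :> nat)%:R = 1 :> R.
Proof. by rewrite -[RHS](sum_delta (fun=> 1) i); under [RHS]eq_bigr do rewrite mulr1. Qed.

Lemma sum_cst_ord (c : R) : \sum_(j < N) c = N%:R * c.
Proof. by rewrite sumr_const card_ord mulr_natl. Qed.

Lemma expect_row_sum_sqr i :
  expect (fun A => (\sum_j centered A i j) ^+ 2) <= N%:R.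
Proof.
under eq_expect do rewrite sqr_sum.
rewrite expect_sum (_ : N%:R = \sum_(j < N) 1); last by rewrite sum_cst_ord mulr1.
apply: ler_sum => j _; rewrite expect_sum -(sum_delta1 j); apply: ler_sum => k _.
apply: (@expect_edge_product2 (i, j) (i, k)).
by rewrite /isolated /same_edge /=; lia.
Qed.

(** An ordered pair meets the same edge only as itself or as its reversal, hence the factor 2. *)
Lemma expect_sum_sqr :
  expect (fun A => (\sum_i \sum_j centered A i j) ^+ 2) <= 2 * N%:R ^+ 2.
Proof.
under eq_expect do rewrite pair_big/= sqr_sum.
rewrite expect_sum.
have -> : 2 * N%:R ^+ 2 = \sum_(e : 'I_N * 'I_N) (1 + 1) :> R.
  rewrite sumr_const card_prod card_ord -[RHS]mulr_natr natrM; ring.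
apply: ler_sum => -[i j] _ /=; rewrite expect_sum.
rewrite -[X in _ <= X + _](sum_delta1 i) -[X in _ <= _ + X](sum_delta1 i).
have d2 (a b : 'I_N) :
    \sum_(e : 'I_N * 'I_N) (a == e.1 :> nat)%:R * (b == e.2 :> nat)%:R = 1 :> R.
  rewrite -(pair_big xpredT xpredT
    (fun k l : 'I_N => (a == k :> nat)%:R * (b == l :> nat)%:R))/=.
  by under eq_bigr do rewrite -mulr_sumr sum_delta1 mulr1; exact: sum_delta1.
rewrite !sum_delta1 -[X in _ <= X + _](d2 i j) -[X in _ <= _ + X](d2 j i) -big_split.
apply: ler_sum => -[k l] _ /=.
apply: le_trans (@expect_edge_product2 (i, j) (k, l) (same_edge (i, j) (k, l)) _) _.
  by rewrite /isolated /=; case: same_edge => //=; rewrite orbT.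
rewrite -!natrM -natrD ler_nat /same_edge /=.
by case: eqP; case: eqP; case: eqP; case: eqP => //=; lia.
Qed.

(** The terms are pairs of walks [i, j, k] and [i, j', k']. No edge is isolated only if the walks
    coincide or both return to [i], and each case leaves N^2 choices. *)
Lemma expect_square_row_sqr i :
  expect (fun A => (\sum_j \sum_k centered A i j * centered A j k) ^+ 2)
  <= 2 * N%:R ^+ 2.
Proof.
under eq_expect do rewrite pair_big/= sqr_sum.
rewrite expect_sum -(pair_big xpredT xpredT (fun j k : 'I_N => expect
  (fun A => \sum_(e : 'I_N * 'I_N) (centered A i j * centered A j k) *
    (centered A i e.1 * centered A e.1 e.2))))/=.
have -> : 2 * N%:R ^+ 2 = \sum_(j < N) \sum_(k < N) (1 + (i == k :> nat)%:R * N%:R) :> R.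
  under eq_bigr do rewrite big_split/= -mulr_suml sum_delta1 mul1r sum_cst_ord mulr1.
  by rewrite sum_cst_ord; ring.
apply: ler_sum => j _; apply: ler_sum => k _; rewrite expect_sum.
rewrite -(pair_big xpredT xpredT (fun j' k' : 'I_N => expect
  (fun A => (centered A i j * centered A j k) * (centered A i j' * centered A j' k'))))/=.
apply: (@le_trans _ _ (\sum_(j' < N) \sum_(k' < N) ((j == j' :> nat)%:R * (k == k' :> nat)%:R
  + (i == k :> nat)%:R * (i == k' :> nat)%:R))).
  apply: ler_sum => j' _; apply: ler_sum => k' _.
  apply: le_trans (@expect_edge_product4 (i, j) (j, k) (i, j') (j', k')
    (((j == j' :> nat) && (k == k' :> nat)) || ((i == k :> nat) && (i == k' :> nat))) _) _.
    by rewrite /isolated /same_edge /=; lia.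
  rewrite -!natrM -natrD ler_nat.
  by case: eqP; case: eqP; case: eqP; case: eqP => //=; lia.
under eq_bigr do rewrite big_split/= -!mulr_sumr !sum_delta1 !mulr1.
by rewrite big_split/= sum_delta1 sum_cst_ord mulrC.
Qed.

(** For given ends [i] and [k], the two middle vertices must agree unless [i = k]. Off the diagonal
    this leaves N terms, on it N^2, so both parts contribute N^3. *)
Lemma expect_square_frobenius :
  expect (fun A => \sum_i \sum_k (\sum_j centered A i j * centered A j k) ^+ 2)
  <= 2 * N%:R ^+ 3.
Proof.
have -> : 2 * N%:R ^+ 3 =
    \sum_(i < N) \sum_(k < N) (N%:R + (i == k :> nat)%:R * N%:R ^+ 2) :> R.
  under eq_bigr do rewrite big_split/= -mulr_suml sum_delta1 mul1r sum_cst_ord.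
  by rewrite sum_cst_ord; ring.
rewrite expect_sum; apply: ler_sum => i _; rewrite expect_sum; apply: ler_sum => k _.
under eq_expect do rewrite sqr_sum.
rewrite expect_sum.
apply: (@le_trans _ _ (\sum_(j < N) \sum_(j' < N) ((j == j' :> nat)%:R + (i == k :> nat)%:R))).
  apply: ler_sum => j _; rewrite expect_sum; apply: ler_sum => j' _.
  apply: le_trans (@expect_edge_product4 (i, j) (j, k) (i, j') (j', k)
    ((j == j' :> nat) || (i == k :> nat)) _) _.
    by rewrite /isolated /same_edge /=; lia.
  by rewrite -natrD ler_nat; case: eqP; case: eqP => //=; lia.
under eq_bigr do rewrite big_split/= sum_delta1 sum_cst_ord.
rewrite sum_cst_ord le_eqVlt; apply/orP; left; apply/eqP; ring.
Qed.

End centered_adjacency.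

(** * Central limit theorem for a row sum *)

Section row_sum_clt.
Local Open Scope classical_set_scope.
Context {R : realType} (p : R).
Hypothesis p01 : 0 < p < 1.

Let p01' : 0 <= p <= 1. Proof. by case/andP: p01 => *; rewrite !ltW. Qed.

(** The coordinate [g_i] of [W u], as a function of the edge set. *)
Definition scaled_row_sum n (A : {set 'I_n.+1 * 'I_n.+1}) (i : 'I_n.+1) : R :=
  (Num.sqrt n.+1%:R)^-1 * \sum_j centered p A i j.

Lemma row_sum_edges n (i : 'I_n.+1) : exists l : seq ('I_n.+1 * 'I_n.+1),
  [/\ uniq l, {subset l <= upper_pairs}, size l = n &
  forall A, \sum_j centered p A i j = \sum_(e <- l) ((e \in A)%:R - p)].
Proof.
exists [seq edge_key i j | j <- enum (predC1 i)]; split.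
- rewrite map_inj_in_uniq ?enum_uniq// => j k _ _ /edge_key_same.
  by rewrite /same_edge/= => ijk; apply: val_inj => /=; lia.
- move=> e /mapP[j]; rewrite mem_enum => ji ->.
  by apply: edge_key_upper; rewrite eq_sym.
- by rewrite size_map -cardE cardC1 card_ord.
- move=> A; rewrite big_map big_enum/= [LHS](bigD1 i)//= mxE eqxx add0r.
  by apply: eq_bigr => j ji; rewrite mxE eq_sym (negbTE ji).
Qed.

Let sqrtVn n : ((Num.sqrt n.+1%:R)^-1 : R) ^+ 2 = n.+1%:R^-1.
Proof. by rewrite exprVn sqr_sqrtr. Qed.

Lemma smoothed_row_sum_clt (e a eta : R) : 0 < e -> 0 < eta ->
  \forall n \near \oo, forall i : 'I_n.+1,
  `|expect p upper_pairs (fun A => gauss_cdf ((a - scaled_row_sum A i) / e))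
    - gauss_cdf (a / Num.sqrt (e ^+ 2 + p * (1 - p)))| <= eta.
Proof.
move=> e0 eta0; have [C C0 step] := gauss_heat_step p01' e0.
have e20 : 0 < e ^+ 2 by rewrite exprn_gt0.
have v0 : 0 < p * (1 - p) by case/andP: p01 => *; rewrite mulr_gt0 ?subr_gt0.
(* The parameter [h] stands for [1 / (n + 1)]. The row has [n] nonzero summands but is scaled by
   [sqrt (n + 1)], hence the variance factor [1 - h]; the [n] cubic errors add up to at most
   [C * sqrt h]. Thus [K] bounds the whole error, independently of [i], and vanishes at 0. *)
pose v (h : R) : R := e ^+ 2 + p * (1 - p) * (1 - h).
pose K (h : R) : R := C * Num.sqrt h + `|gauss_cdf (a / Num.sqrt (v h)) -
  gauss_cdf (a / Num.sqrt (v 0))|.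
have v00 : v 0 = e ^+ 2 + p * (1 - p) by rewrite /v subr0 mulr1.
have cK : {for 0, continuous K}.
  apply: continuousD.
    by apply: continuousM; [exact: cst_continuous|exact: sqrt_continuous].
  apply: continuous_comp; last exact: norm_continuous.
  apply: continuousB; last exact: cst_continuous.
  apply: continuous_comp; last exact: continuous_gauss_cdf.
  apply: continuousM; first exact: cst_continuous.
  apply: continuousV; first by rewrite gt_eqF// sqrtr_gt0 v00 addr_gt0.
  apply: continuous_comp; last exact: sqrt_continuous.
  apply: continuousD; first exact: cst_continuous.
  apply: continuousM; first exact: cst_continuous.
  by apply: continuousB; [exact: cst_continuous|exact: cvg_id].
have K0 : K 0 = 0 by rewrite /K sqrtr0 mulr0 subrr normr0 addr0.
have : K n.+1%:R^-1 @[n --> \oo] --> K 0.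
  exact: (cvg_comp _ _ (@cvg_harmonic R) cK).
rewrite K0 => /cvgrPdist_le /(_ _ eta0); apply: filterS => n /=.
rewrite sub0r normrN => Kn i; apply: le_trans (le_trans (ler_norm _) Kn).
have [l [ul lD sl lE]] := row_sum_edges i.
set y := (Num.sqrt n.+1%:R)^-1 : R.
have y0 : 0 <= y by rewrite invr_ge0 sqrtr_ge0.
have y2 : y ^+ 2 = n.+1%:R^-1 by exact: sqrtVn.
have ny : n%:R * y ^+ 2 = 1 - n.+1%:R^-1.
  rewrite y2 (_ : n%:R = n.+1%:R - 1); last by rewrite -natr1 addrK.
  by rewrite mulrBl mul1r divff// pnatr_eq0.
have hstep s x : e ^+ 2 <= s ->
  `|p * gauss_cdf ((x - (1 - p) * y) / Num.sqrt s)
    + (1 - p) * gauss_cdf ((x + p * y) / Num.sqrt s)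
    - gauss_cdf (x / Num.sqrt (s + p * (1 - p) * y ^+ 2))| <= C * y ^+ 3.
  by move=> es; exact: step.
have := @expect_gauss_cdf _ _ p upper_pairs p01' _ _ y l (e ^+ 2) a hstep ul lD (lexx _).
rewrite sqrtr_sqr (gtr0_norm e0) sl.
have -> : n%:R * (p * (1 - p) * y ^+ 2) = p * (1 - p) * (1 - n.+1%:R^-1).
  by rewrite -ny; ring.
rewrite -/(v _) => H.
rewrite (_ : expect _ _ _ = expect p upper_pairs (fun A => gauss_cdf
   ((a - y * \sum_(e0 <- l) ((e0 \in A)%:R - p)) / e))); last first.
  by apply: eq_expect => A; rewrite /scaled_row_sum lE.
apply: le_trans (ler_distD (gauss_cdf (a / Num.sqrt (v (n.+1%:R^-1)))) _ _) _.
rewrite -v00 lerD2r; apply: le_trans H _.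
have -> : Num.sqrt (n.+1%:R^-1) = y by rewrite -y2 sqrtr_sqr ger0_norm.
have -> : n%:R * (C * y ^+ 3) = (n%:R * y ^+ 2) * (C * y) by ring.
rewrite ny ler_piMl ?mulr_ge0// lerBlDr lerDl.
Qed.

(** Up to Gaussian tails of mass [eta / 4], the indicator of [S <= x] lies between the smooth tests
    of width [e] centered at [x - M * e] and [x + M * e]. The cutoff [M] is fixed by the tails
    before [e] is chosen, so small that neither the shift nor the added variance [e^2] moves the
    limit by more than [eta / 4]. *)
Lemma row_sum_clt (x eta : R) : 0 < eta -> \forall n \near \oo, forall i : 'I_n.+1,
  `|expect p upper_pairs (fun A => (scaled_row_sum A i <= x)%R%:R)
    - gauss_cdf (x / Num.sqrt (p * (1 - p)))| <= eta.
Proof.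
move=> eta0; have eta4 : 0 < eta / 4 by rewrite divr_gt0.
have [M M0 [Mlo Mhi]] := gauss_cdf_tails eta4.
have v0 : 0 < p * (1 - p) by case/andP: p01 => *; rewrite mulr_gt0 ?subr_gt0.
pose G (c e : R) : R := gauss_cdf ((x + c * e) / Num.sqrt (e ^+ 2 + p * (1 - p))).
have G0 c : G c 0 = gauss_cdf (x / Num.sqrt (p * (1 - p))).
  by rewrite /G mulr0 addr0 expr0n add0r.
have cG c : {for 0, continuous (G c)}.
  apply: continuous_comp; last exact: continuous_gauss_cdf.
  apply: continuousM.
    apply: continuousD; first exact: cst_continuous.
    by apply: continuousM; [exact: cst_continuous|exact: cvg_id].
  apply: continuousV; first by rewrite expr0n add0r gt_eqF// sqrtr_gt0.
  apply: continuous_comp; last exact: sqrt_continuous.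
  apply: continuousD; last exact: cst_continuous.
  exact: exprn_continuous.
have [e e0 [eM eN]] : exists2 e : R, 0 < e &
    `|G M 0 - G M e| <= eta / 4 /\ `|G (- M) 0 - G (- M) e| <= eta / 4.
  have [d1 d10 h1] : \forall e \near (0 : R), `|G M 0 - G M e| <= eta / 4.
    by have /cvgrPdist_le/(_ _ eta4) := cG M.
  have [d2 d20 h2] : \forall e \near (0 : R), `|G (- M) 0 - G (- M) e| <= eta / 4.
    by have /cvgrPdist_le/(_ _ eta4) := cG (- M).
  have dm : 0 < Num.min d1 d2 by rewrite lt_min d10.
  exists (Num.min d1 d2 / 2); first by rewrite divr_gt0.
  have lt1 : `|0 - Num.min d1 d2 / 2| < Num.min d1 d2.
    by rewrite sub0r normrN gtr0_norm ?divr_gt0//; lra.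
  by split; [apply: h1|apply: h2]; rewrite /= (lt_le_trans lt1)// ge_min lexx ?orbT.
have n1 := smoothed_row_sum_clt (x + M * e) e0 eta4.
have n2 := smoothed_row_sum_clt (x + - M * e) e0 eta4.
apply: filterS2 n1 n2 => n /[swap] H2 /[swap] i /(_ i) H1; move: {H2}(H2 i) => H2.
have up : expect p upper_pairs (fun A => (scaled_row_sum A i <= x)%R%:R) <=
    expect p upper_pairs (fun A => gauss_cdf ((x + M * e - scaled_row_sum A i) / e)) + eta / 4.
  rewrite -[X in _ + X](expect_cst p (@upper_pairs n.+1)) -expectD; apply: expect_le => // A.
  have [Fx|_] := leP (scaled_row_sum A i) x; last first.
    by rewrite addr_ge0 ?gauss_cdf_ge0// ltW.
  rewrite -lerBlDr (le_trans Mhi)//; apply: gauss_cdf_le.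
  by rewrite ler_pdivlMr//; lra.
have lo : expect p upper_pairs (fun A => gauss_cdf ((x + - M * e - scaled_row_sum A i) / e))
    - eta / 4 <= expect p upper_pairs (fun A => (scaled_row_sum A i <= x)%R%:R).
  rewrite -[X in _ - X](expect_cst p (@upper_pairs n.+1)) -expectB; apply: expect_le => // A.
  rewrite lerBlDr; have [Fx|Fx] := leP (scaled_row_sum A i) x.
    by rewrite (le_trans (gauss_cdf_le1 _))// lerDl ltW.
  rewrite add0r (le_trans _ Mlo)//; apply: gauss_cdf_le.
  by rewrite ler_pdivrMr//; lra.
move: H1 H2 eM eN up lo; rewrite -/(G M e) -/(G (- M) e) !G0; clear.
move: (expect _ _ _) (expect _ _ _) (expect _ _ _) (G M e) (G (- M) e) (gauss_cdf _).
move=> a b c f g h; rewrite !ler_norml.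
do 4! move=> /andP[? ?]; move=> ? ?; apply/andP; split; lra.
Qed.

End row_sum_clt.

(** * Euclidean geometry and the Rayleigh quotient *)

Section euclid.
Context {R : realType} {n : nat}.
Implicit Types (x y z : 'cV[R]_n) (A : 'M[R]_n) (c : R).

Definition dot x y : R := \sum_i x i 0 * y i 0.

Definition enorm x : R := Num.sqrt (dot x x).

Lemma dotC x y : dot x y = dot y x.
Proof. by apply: eq_bigr => i _; rewrite mulrC. Qed.

Lemma dotDl x y z : dot (x + y) z = dot x z + dot y z.
Proof. by rewrite -big_split; apply: eq_bigr => i _; rewrite mxE mulrDl. Qed.

Lemma dotDr x y z : dot x (y + z) = dot x y + dot x z.
Proof. by rewrite dotC dotDl !(dotC x). Qed.

Lemma dotZl c x y : dot (c *: x) y = c * dot x y.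
Proof. by rewrite mulr_sumr; apply: eq_bigr => i _; rewrite mxE mulrA. Qed.

Lemma dotZr c x y : dot x (c *: y) = c * dot x y.
Proof. by rewrite dotC dotZl dotC. Qed.

Lemma dotNl x y : dot (- x) y = - dot x y.
Proof. by rewrite -scaleN1r dotZl mulN1r. Qed.

Lemma dotNr x y : dot x (- y) = - dot x y.
Proof. by rewrite dotC dotNl dotC. Qed.

Lemma dot_ge0 x : 0 <= dot x x.
Proof. by apply: sumr_ge0 => i _; rewrite -expr2 sqr_ge0. Qed.

Lemma dot_eq0 x : dot x x = 0 -> x = 0.
Proof.
move=> /eqP; rewrite psumr_eq0 => [/allP x0|i _]; last by rewrite -expr2 sqr_ge0.
apply/colP => i; rewrite mxE; apply/eqP.
by have := x0 i (mem_index_enum _); rewrite -expr2 expf_eq0.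
Qed.

Lemma dot_mulmx A x y : A^T = A -> dot x (A *m y) = dot (A *m x) y.
Proof.
move=> AT; transitivity ((x^T *m (A *m y)) 0 0).
  by rewrite mxE; apply: eq_bigr => i _; rewrite [in RHS]mxE.
rewrite mulmxA -[x^T *m A]trmxK trmx_mul trmxK AT mxE.
by apply: eq_bigr => i _; rewrite [in LHS]mxE.
Qed.

Lemma enorm_ge0 x : 0 <= enorm x.
Proof. exact: sqrtr_ge0. Qed.

Lemma enormE x : enorm x ^+ 2 = dot x x.
Proof. by rewrite sqr_sqrtr// dot_ge0. Qed.

Lemma cauchy_schwarz x y : `|dot x y| <= enorm x * enorm y.
Proof.
have [x0|x0] := eqVneq (enorm x) 0.
  have /dot_eq0 -> : dot x x = 0 by rewrite -enormE x0 expr0n.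
  by rewrite -(scale0r y) dotZl mul0r normr0 mulr_ge0// enorm_ge0.
have {}x0 : 0 < enorm x by rewrite lt_def x0 enorm_ge0.
rewrite -(@ler_pXn2r _ 2)// ?nnegrE ?normr_ge0 ?mulr_ge0 ?enorm_ge0//.
rewrite real_normK ?num_real// exprMn !enormE.
have : 0 <= dot (dot x x *: y - dot x y *: x) (dot x x *: y - dot x y *: x).
  exact: dot_ge0.
rewrite !(dotDl, dotDr, dotNl, dotNr, dotZl, dotZr) (dotC y x).
set a := dot x x; set b := dot x y; set c := dot y y => H.
have a0 : 0 < a by rewrite /a -enormE exprn_gt0.
rewrite -subr_ge0 -(pmulr_rge0 _ a0); move: H; congr (_ <= _); ring.
Qed.

Lemma enormZ c x : enorm (c *: x) = `|c| * enorm x.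
Proof. by rewrite /enorm dotZl dotZr mulrA -expr2 sqrtrM ?sqr_ge0// sqrtr_sqr. Qed.

Lemma coord_le_enorm x i : `|x i 0| <= enorm x.
Proof.
rewrite -sqrtr_sqr ler_wsqrtr// /dot (bigD1 i)//= expr2 lerDl.
by apply: sumr_ge0 => j _; rewrite -expr2 sqr_ge0.
Qed.

(* [|Ax|^2 = <x, A^2 x> <= |A^2 x| |x|], and a Frobenius norm dominates the
   operator norm. *)
Lemma enorm_mulmx_frobenius A x : A^T = A ->
  enorm (A *m x) ^+ 4 <= (\sum_i \sum_k (A *m A) i k ^+ 2) * enorm x ^+ 4.
Proof.
move=> AT; have F y (B : 'M[R]_n) :
    enorm (B *m y) ^+ 2 <= (\sum_i \sum_k B i k ^+ 2) * enorm y ^+ 2.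
  rewrite enormE mulr_suml; apply: ler_sum => i _.
  have -> : (B *m y) i 0 = dot (row i B)^T y.
    by rewrite mxE; apply: eq_bigr => k _; rewrite !mxE.
  have -> : \sum_k B i k ^+ 2 = enorm (row i B)^T ^+ 2.
    by rewrite enormE; apply: eq_bigr => k _; rewrite !mxE expr2.
  rewrite -expr2 -exprMn -real_normK ?num_real//.
  by rewrite lerXn2r ?nnegrE ?mulr_ge0 ?enorm_ge0// cauchy_schwarz.
have H : enorm (A *m x) ^+ 2 <= enorm x * enorm (A *m A *m x).
  rewrite enormE -dot_mulmx// mulmxA.
  exact: le_trans (ler_norm _) (cauchy_schwarz _ _).
have -> : enorm (A *m x) ^+ 4 = (enorm (A *m x) ^+ 2) ^+ 2 by rewrite -exprM.
apply: (@le_trans _ _ ((enorm x * enorm (A *m A *m x)) ^+ 2)).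
  by rewrite lerXn2r ?nnegrE ?mulr_ge0 ?enorm_ge0// sqr_ge0.
rewrite exprMn (_ : enorm x ^+ 4 = enorm x ^+ 2 * enorm x ^+ 2) -?exprD//.
by rewrite exprD mulrA [leRHS]mulrC ler_wpM2l ?sqr_ge0.
Qed.

End euclid.

Section rayleigh.
Local Open Scope classical_set_scope.
Context {R : realType} {n : nat}.
Implicit Types (A : 'M[R]_n.+1) (x y : 'cV[R]_n.+1).

Lemma sum_continuous (T : topologicalType) (J : Type) (r : seq J) (F : J -> T -> R) :
  (forall j, continuous (F j)) -> continuous (fun t => \sum_(j <- r) F j t).
Proof.
move=> cF; elim: r => [|j r IH].
  under eq_fun do rewrite big_nil; exact: cst_continuous.
under eq_fun do rewrite big_cons.
by move=> t; apply: continuousD; [exact: cF|exact: IH].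
Qed.

Lemma dot_continuous A :
  continuous (fun v : 'rV[R]_n.+1 => dot v^T (A *m v^T)).
Proof.
have cc i : continuous (fun v : 'rV[R]_n.+1 => v^T i 0 : R).
  under eq_fun do rewrite mxE.
  exact: coord_continuous.
apply: sum_continuous => i v; apply: continuousM; first exact: cc.
have -> : (fun w : 'rV[R]_n.+1 => (A *m w^T) i 0) = (fun w => \sum_j A i j * w^T j 0).
  by apply/funext => w; rewrite mxE.
apply: sum_continuous => j w; apply: continuousM; [exact: cst_continuous|exact: cc].
Qed.

(** The maximum is attained on the compact unit sphere and carried to all vectors by homogeneity. *)
Lemma quadratic_form_max A : exists2 x, dot x x = 1 &
  forall y, dot y (A *m y) <= dot x (A *m x) * dot y y.
Proof.
pose S := [set v : 'rV[R]_n.+1 | dot v^T v^T = 1].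
have S0 : S !=set0.
  exists (delta_mx 0 0); rewrite /S/= /dot (bigD1 0)//= !mxE !eqxx mulr1.
  by rewrite big1 ?addr0// => i i0; rewrite !mxE (negbTE i0) mulr0.
have cS : compact S.
  apply: bounded_closed_compact.
    exists 1; split => // M M1 v /= v1; rewrite [leLHS]/Num.norm/= mx_normrE.
    apply/bigmax_leP; split; first by rewrite (le_trans _ (ltW M1)).
    move=> [i j] _ /=; rewrite (ord1 i) (le_trans _ (ltW M1))//.
    have := coord_le_enorm v^T j; rewrite mxE => /le_trans; apply.
    by rewrite /enorm v1 sqrtr1.
  have -> : S = (fun v : 'rV[R]_n.+1 => dot v^T (1%:M *m v^T)) @^-1` [set x | x = 1].
    by apply/seteqP; split => v; rewrite /S /= mul1mx.
  apply: preimage_closed; last exact: closed_eq.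
  by move=> v _; exact: dot_continuous.
have [|c] := @compact_EVT_max _ R (fun v : 'rV[R]_n.+1 => dot v^T (A *m v^T)) S S0 cS.
  by apply: continuous_subspaceT; exact: dot_continuous.
rewrite inE => c1 cmax; exists c^T => // y.
have [y0|y0] := eqVneq (dot y y) 0.
  by rewrite y0 mulr0 (dot_eq0 y0) mulmx0 -(scale0r (0 : 'cV_n.+1)) dotZl mul0r.
have y0' : 0 < dot y y by rewrite lt_def y0 dot_ge0.
have e0 : enorm y != 0 by rewrite gt_eqF// sqrtr_gt0.
have := cmax ((enorm y)^-1 *: y)^T; rewrite inE /S /= !trmxK -scalemxAr.
rewrite !(dotZl, dotZr) -(enormE y) => /(_ _) H.
rewrite -ler_pdivrMr ?exprn_gt0 ?lt_def ?e0 ?enorm_ge0//.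
apply: le_trans (H _); last by field.
by rewrite le_eqVlt; apply/orP; left; apply/eqP; field.
Qed.

(* A maximizer [x] of the form on the unit sphere, with value [m], is an
   eigenvector: [m - A] is positive semidefinite and its form vanishes at [x]. *)
Lemma rayleigh_le A (a : R) : A^T = A -> largest_eigenvalue A a ->
  forall x, dot x (A *m x) <= a * dot x x.
Proof.
move=> AT [_ amax]; have [x x1 xmax] := quadratic_form_max A.
set m := dot x (A *m x) in xmax.
pose B := m%:M - A; have BE y : B *m y = m *: y - A *m y.
  by rewrite mulmxBl mul_scalar_mx.
have Bge y : 0 <= dot y (B *m y).
  by rewrite BE dotDr dotNr dotZr subr_ge0.
have BT : B^T = B by rewrite linearB/= tr_scalar_mx AT.
have Bx : B *m x = 0.
  have xBx : dot x (B *m x) = 0 by rewrite BE dotDr dotNr dotZr x1 mulr1 subrr.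
  set z := B *m x; apply: dot_eq0.
  have key t : 0 <= 2 * t * dot z z + t ^+ 2 * dot z (B *m z).
    have := Bge (x + t *: z); rewrite mulmxDr -scalemxAr.
    rewrite !(dotDl, dotDr, dotZl, dotZr) xBx (dot_mulmx x z BT) -/z; congr (_ <= _); ring.
  have [zz0|] := eqVneq (dot z z) 0; first by [].
  move=> zz0; have zz : 0 < dot z z by rewrite lt_def zz0 dot_ge0.
  set c := dot z (B *m z) in key.
  have c0 : 0 <= c by exact: Bge.
  (* At this [t] the negative linear term of [key] outweighs the quadratic one, a contradiction. The
     denominator is [c + 1] because [c] may be zero. *)
  have := key (- (dot z z / (c + 1))).
  have c1 : 0 < c + 1 by lra.
  have -> : 2 * - (dot z z / (c + 1)) * dot z z + (- (dot z z / (c + 1))) ^+ 2 * c =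
     - (dot z z / (c + 1)) * (dot z z / (c + 1)) * (c + 2).
    by field; rewrite gt_eqF.
  have : 0 < (dot z z / (c + 1)) * (dot z z / (c + 1)) * (c + 2).
    by rewrite !mulr_gt0 ?invr_gt0//; lra.
  by rewrite !mulNr; lra.
have me : eigenvalue A m.
  (* [eigenvalue] refers to row vectors; the symmetry of [A] allows transposing. *)
  apply/eigenvalueP; exists x^T.
    rewrite -[A]AT -trmx_mul; apply: (can_inj (@trmxK _ _ _)); rewrite trmxK linearZ/= trmxK.
    by apply/eqP; rewrite eq_sym -subr_eq0 -BE Bx.
  apply: contra_eq_neq x1 => /(congr1 trmx); rewrite trmxK trmx0 => ->.
  by rewrite -(scale0r (0 : 'cV_n.+1)) dotZl mul0r eq_sym oner_neq0.
move=> y; apply: le_trans (xmax y) _; apply: ler_wpM2r; first exact: dot_ge0.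
exact: amax.
Qed.

End rayleigh.

(** * Deterministic expansion of the top eigenvector *)

(* In this lemma and the next, [m] is the fourth root of the number of vertices,
   [L = lam + p], [a = <u, v>] for the normalized all-one vector [u],
   [rho = |v - a u|], [g = W u], [gu = <g, u>], [gr = <g, v - a u>],
   [gi = g_i], [s = (W (v - a u))_i], [wg = (W g)_i],
   [wwr = (W W (v - a u))_i] and [vi = v_i]. *)
Lemma eigenvector_scalar_estimates (R : realType) (p k m L a rho gu gr gi s wg wwr : R) :
  0 < p < 1 -> 1 <= k -> 8 * k / p <= m ->
  p * m ^+ 4 - k <= L -> L <= p * m ^+ 4 * a ^+ 2 + k * m ^+ 3 ->
  0 <= a -> 0 <= rho -> rho ^+ 2 = 1 - a ^+ 2 ->
  L * rho ^+ 2 <= k * m ^+ 2 * rho + k * m ^+ 3 * rho ^+ 2 ->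
  (L - p * m ^+ 4) * a = a * gu + gr -> `|gu| <= k -> `|gr| <= k * m ^+ 2 * rho ->
  L * s = a * wg + wwr - (a * gu + gr) * gi ->
  `|wg| <= k * m ^+ 2 -> `|wwr| <= m ^+ 2 * (k * m ^+ 3 * rho) -> `|gi| <= k ->
  [/\ 8 <= m, p * m ^+ 4 / 2 <= L, a <= 1, p * m ^+ 2 * rho <= 2 * k &
    `|L - p * m ^+ 4| <= k + 4 * k ^+ 2 / p /\
    `|s| <= 2 * (k + 2 * k ^+ 2 / p + k ^+ 2 + 2 * k ^+ 3 / p) / p / m].
Proof.
move=> /andP[p0 p1] k1 hm hL1 hL2 a0 rho0 rho2 hLr hLa hgu hgr hs hwg hwwr hgi.
have k0 : 0 < k by lra.
pose c2 := k + 4 * k ^+ 2 / p.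
pose c3 := k + 2 * k ^+ 2 / p + k ^+ 2 + 2 * k ^+ 3 / p.
have k20 : 0 <= k ^+ 2 / p by rewrite divr_ge0 ?exprn_ge0 ?ltW.
have k30 : 0 <= k ^+ 3 / p by rewrite divr_ge0 ?exprn_ge0 ?ltW.
have pm : 8 * k <= p * m by rewrite [p * m]mulrC -ler_pdivrMr.
have m1 : 1 <= m by nra.
have m0 : 0 < m by lra.
have m20 : 0 < m ^+ 2 by rewrite exprn_gt0.
have m30 : 0 < m ^+ 3 by rewrite exprn_gt0.
have m40 : 0 < m ^+ 4 by rewrite exprn_gt0.
have m21 : 1 <= m ^+ 2 by rewrite exprn_ege1.
have m31 : 1 <= m ^+ 3 by rewrite exprn_ege1.
have m32 : m ^+ 2 <= m ^+ 3 by rewrite (exprS _ 2) ler_peMl// ltW.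
(* The threshold on [m] makes [k * m^3], and so also [k], at most an eighth of [p * m^4]. Comparing
   the two bounds on [L] then forces [a^2 >= 3/4]. *)
have km3 : 8 * (k * m ^+ 3) <= p * m ^+ 4.
  by rewrite (exprS m 3) mulrA [p * _]mulrA ler_wpM2r// ltW.
have kkm3 : k <= k * m ^+ 3 by rewrite ler_peMr// ltW.
have pm40 : 0 < p * m ^+ 4 by rewrite mulr_gt0.
have a2 : 3 / 4 <= a ^+ 2.
  rewrite -(ler_pM2l pm40); lra.
have a1 : a <= 1 by have := sqr_ge0 rho; nra.
have ah : 1 / 2 <= a by nra.
have Lh : p * m ^+ 4 / 2 <= L by lra.
have L0 : 0 < L by lra.
(* Since [L - k * m^3 >= p * m^4 / 2], the quadratic term on the right is absorbed on the left, and
   one factor [rho] cancels. *)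
have hrho : p * m ^+ 2 * rho <= 2 * k.
  have [->|rn0] := eqVneq rho 0; first lra.
  have rp : 0 < rho by rewrite lt_def rn0.
  have : p * m ^+ 4 / 2 * rho ^+ 2 <= k * m ^+ 2 * rho.
    have : (p * m ^+ 4 / 2) * rho ^+ 2 <= (L - k * m ^+ 3) * rho ^+ 2.
      by rewrite ler_wpM2r ?sqr_ge0//; lra.
    by lra.
  have -> : p * m ^+ 4 / 2 * rho ^+ 2 = (p * m ^+ 2 * rho) * (m ^+ 2 * rho) / 2 by field.
  by move=> H; rewrite -(ler_pM2r (mulr_gt0 m20 rp)); lra.
have hrho' : m ^+ 2 * rho <= 2 * k / p by rewrite ler_pdivlMr//; lra.
have kr : k * (m ^+ 2 * rho) <= 2 * k ^+ 2 / p.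
  have := ler_wpM2l (ltW k0) hrho'; lra.
have hLp : `|L - p * m ^+ 4| <= c2.
  have : `|L - p * m ^+ 4| * a <= a * k + k * m ^+ 2 * rho.
    rewrite -{1}(ger0_norm a0) -normrM hLa; apply: le_trans (ler_normD _ _) _.
    by rewrite normrM (ger0_norm a0) lerD// ler_wpM2l.
  move: (normr_ge0 (L - p * m ^+ 4)) ah kr k20; rewrite /c2; clear; set X := `|_|; nra.
(* The largest term of [L * s] is [wwr], of order [m^5 * rho = O(m^3)]; dividing by [L], of order
   [m^4], leaves the final rate [1 / m]. *)
have hsm : `|s| <= 2 * c3 / p / m.
  have : L * `|s| <= c3 * m ^+ 3.
    rewrite -{1}(ger0_norm (ltW L0)) -normrM hs.
    have h1 : `|a * wg| <= k * m ^+ 3.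
      rewrite normrM (ger0_norm a0); apply: (@le_trans _ _ `|wg|); first by rewrite ler_piMl.
      by apply: le_trans hwg _; rewrite ler_wpM2l// ltW.
    have h2 : `|wwr| <= 2 * k ^+ 2 / p * m ^+ 3.
      apply: le_trans hwwr _; have := ler_wpM2r (ltW m30) kr; lra.
    have h3 : `|(a * gu + gr) * gi| <= (k ^+ 2 + 2 * k ^+ 3 / p) * m ^+ 3.
      have h4 : `|a * gu + gr| <= k + 2 * k ^+ 2 / p.
        apply: le_trans (ler_normD _ _) _; rewrite lerD//; last by apply: le_trans hgr _; lra.
        by rewrite normrM (ger0_norm a0); apply: le_trans hgu; rewrite ler_piMl.
      rewrite normrM; apply: (@le_trans _ _ ((k + 2 * k ^+ 2 / p) * k)).
        by apply: ler_pM.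
      have -> : (k + 2 * k ^+ 2 / p) * k = k ^+ 2 + 2 * k ^+ 3 / p by field; rewrite gt_eqF.
      by rewrite ler_peMr//; have := exprn_ge0 2 (ltW k0); lra.
    apply: le_trans (ler_normB _ _) _; apply: le_trans (lerD (ler_normD _ _) (lexx _)) _.
    by rewrite /c3; lra.
  have : p * m ^+ 4 / 2 * `|s| <= L * `|s| by rewrite ler_wpM2r.
  move=> h1 h2; rewrite ler_pdivlMr// ler_pdivlMr//.
  rewrite -(ler_pM2r m30).
  have -> : `|s| * m * p * m ^+ 3 = 2 * (p * m ^+ 4 / 2 * `|s|) by field.
  lra.
have m8 : 8 <= m by nra.
by [].
Qed.

Lemma eigenvector_scalar_bound (R : realType) (p k c2 c3 : R) :
  0 < p < 1 -> 0 <= k -> 0 <= c2 -> 0 <= c3 ->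
  exists2 C : R, 0 <= C & forall m L a rho gi s vi : R, 8 <= m ->
  p * m ^+ 4 / 2 <= L -> 0 <= a <= 1 -> 0 <= rho -> rho ^+ 2 = 1 - a ^+ 2 ->
  p * m ^+ 2 * rho <= 2 * k -> `|L - p * m ^+ 4| <= c2 -> `|s| <= c3 / m ->
  `|gi| <= k -> L * vi = p * m ^+ 2 * a + a * gi + s ->
  `|m ^+ 2 * (Num.sqrt (L - p) * vi - Num.sqrt p) - gi / Num.sqrt p| <= C / m.
Proof.
move=> /andP[p0 p1] k0 c20 c30.
pose c4 := 2 * c2 / p + 4; pose c5 := c4 + 4 * k ^+ 2 / p ^+ 2.
have c40 : 0 <= c4 by rewrite /c4 addr_ge0// divr_ge0 ?mulr_ge0// ltW.
have c50 : 0 <= c5.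
  by rewrite /c5 addr_ge0// divr_ge0 ?mulr_ge0 ?exprn_ge0// ltW.
pose q := Num.sqrt p.
have q0 : 0 < q by rewrite sqrtr_gt0.
have q2 : q ^+ 2 = p by rewrite sqr_sqrtr// ltW.
exists (q * c5 + c5 * k / q + (1 + c4) * c3 / q).
  have qV : 0 <= q^-1 by rewrite invr_ge0 ltW.
  by rewrite !addr_ge0// !mulr_ge0// ?(ltW q0)// addr_ge0.
move=> m L a rho gi s vi m8 Lh /andP[a0 a1] rho0 rho2 hrho hLp hsm hgi hvi.
have m1 : 1 <= m by lra.
have m0 : 0 < m by lra.
have m40 : 0 < m ^+ 4 by rewrite exprn_gt0.
have L0 : 0 < L by apply: lt_le_trans Lh; rewrite divr_gt0// mulr_gt0.
pose l := Num.sqrt (L - p).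
have m4 : 2 <= m ^+ 4.
  apply: (@le_trans _ _ m); first by lra.
  by rewrite (exprS m 3) ler_peMr// ?exprn_ege1// ltW.
have Lp : 0 <= L - p.
  rewrite subr_ge0; apply: le_trans Lh; rewrite -mulrA ler_peMr ?(ltW p0)//.
  by rewrite ler_pdivlMr// mul1r.
have l2 : l ^+ 2 = L - p by rewrite sqr_sqrtr.
have l0 : 0 <= l by exact: sqrtr_ge0.
(* The ratio of [sqrt (p N lam)] to [lam + p]. It rewrites [m^2 * l * vi] as [ga * (L * vi) / q], so
   that the coordinate equation applies and only [ga * a - 1] and [s] remain to be estimated. *)
pose ga := m ^+ 2 * q * l / L.
have ga0 : 0 <= ga by rewrite divr_ge0 ?mulr_ge0// ltW.
have LV : L^-1 <= 2 / p / m ^+ 4.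
  rewrite -[leRHS]invrK lef_pV2 ?posrE// ?invr_gt0 ?divr_gt0//.
  apply: le_trans Lh; rewrite le_eqVlt; apply/orP; left; apply/eqP; field.
  by rewrite !gt_eqF.
have hga2 : `|ga ^+ 2 - 1| <= c4 / m ^+ 4.
  have -> : ga ^+ 2 - 1 = (p * m ^+ 4 - L) / L - p ^+ 2 * m ^+ 4 / L ^+ 2.
    have -> : ga ^+ 2 = (m ^+ 4 * q ^+ 2 * l ^+ 2) / L ^+ 2.
      by rewrite /ga; field; rewrite gt_eqF.
    by rewrite q2 l2; field; rewrite gt_eqF.
  have LV0 : 0 < L^-1 by rewrite invr_gt0.
  apply: le_trans (ler_normB _ _) _.
  rewrite normrM distrC (gtr0_norm LV0) [X in _ + X <= _]ger0_norm; last first.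
    by rewrite divr_ge0 ?mulr_ge0 ?exprn_ge0// ltW.
  have h1 : `|L - p * m ^+ 4| / L <= c2 * (2 / p / m ^+ 4) by apply: ler_pM => //; exact: ltW.
  have h2 : p ^+ 2 * m ^+ 4 / L ^+ 2 <= p ^+ 2 * m ^+ 4 * (2 / p / m ^+ 4) ^+ 2.
    have LL : (L ^+ 2)^-1 <= (2 / p / m ^+ 4) ^+ 2.
      by rewrite -exprVn lerXn2r// nnegrE ltW// !divr_gt0.
    by rewrite ler_wpM2l// mulr_ge0 ?exprn_ge0// ltW.
  have h3 : p ^+ 2 * m ^+ 4 * (2 / p / m ^+ 4) ^+ 2 = 4 / m ^+ 4 by field; rewrite !gt_eqF.
  have h4 : c4 / m ^+ 4 = c2 * (2 / p / m ^+ 4) + 4 / m ^+ 4.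
    by rewrite /c4; field; rewrite !gt_eqF.
  by rewrite h4 -h3; apply: lerD.
have hga : `|ga - 1| <= c4 / m ^+ 4.
  apply: le_trans hga2; rewrite (_ : ga ^+ 2 - 1 = (ga - 1) * (ga + 1)); last ring.
  rewrite normrM ler_peMr// ger0_norm ?addr_ge0//.
  by rewrite lerDr.
have hgaa : `|ga * a - 1| <= c5 / m ^+ 4.
  have -> : ga * a - 1 = (ga - 1) * a - (1 - a) by ring.
  apply: le_trans (ler_normB _ _) _; rewrite normrM (ger0_norm a0).
  rewrite [X in _ + X <= _]ger0_norm ?subr_ge0// /c5 mulrDl lerD//.
    by apply: le_trans hga; rewrite ler_piMr.
  (* From [1 - a <= 1 - a^2 = rho^2], the defect of [a] is quadratic in [rho], hence O(m^-4); it is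
     later multiplied by [m^2]. *)
  apply: (@le_trans _ _ (rho ^+ 2)); first by rewrite rho2; move: a0 a1; clear; nra.
  rewrite ler_pdivlMr// ler_pdivlMr ?exprn_gt0//.
  have -> : rho ^+ 2 * m ^+ 4 * p ^+ 2 = (p * m ^+ 2 * rho) ^+ 2 by ring.
  have -> : 4 * k ^+ 2 = (2 * k) ^+ 2 by ring.
  by rewrite lerXn2r ?nnegrE// !mulr_ge0// ltW.
have -> : m ^+ 2 * (l * vi - q) - gi / q =
    q * m ^+ 2 * (ga * a - 1) + (ga * a - 1) * gi / q + ga * s / q.
  have -> : vi = (p * m ^+ 2 * a + a * gi + s) / L.
    by rewrite -hvi mulrC mulKf// gt_eqF.
  by rewrite /ga -q2; field; rewrite !gt_eqF.
have mV0 : 0 < m^-1 by rewrite invr_gt0.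
have t1 : `|q * m ^+ 2 * (ga * a - 1)| <= q * c5 / m.
  have qm : 0 <= q * m ^+ 2 by apply: mulr_ge0; [exact: ltW|exact: sqr_ge0].
  rewrite normrM (ger0_norm qm).
  apply: (@le_trans _ _ (q * m ^+ 2 * (c5 / m ^+ 4))); first by rewrite ler_wpM2l.
  have -> : q * m ^+ 2 * (c5 / m ^+ 4) = q * c5 / m * m^-1 by field; rewrite gt_eqF.
  by rewrite ler_piMr ?invf_le1// divr_ge0 ?mulr_ge0 ?(ltW q0) ?(ltW m0).
have t2 : `|(ga * a - 1) * gi / q| <= c5 * k / q / m.
  rewrite 2!normrM normfV (gtr0_norm q0) [leRHS]mulrAC ler_wpM2r ?invr_ge0 ?(ltW q0)//.
  rewrite [leRHS]mulrAC; apply: ler_pM => //; apply: le_trans hgaa _.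
  by rewrite ler_wpM2l// lef_pV2 ?posrE// (exprS m 3) ler_peMr ?(ltW m0)// exprn_ege1.
have t3 : `|ga * s / q| <= (1 + c4) * c3 / q / m.
  rewrite 2!normrM normfV (gtr0_norm q0) [leRHS]mulrAC ler_wpM2r ?invr_ge0 ?(ltW q0)//.
  rewrite -[leRHS]mulrA; apply: ler_pM => //; rewrite (ger0_norm ga0).
  have : c4 / m ^+ 4 <= c4.
    by rewrite ler_piMr// invf_le1// exprn_ege1.
  by move: hga; rewrite ler_norml => /andP[_]; lra.
apply: le_trans (ler_normD _ _) _; apply: le_trans (lerD (ler_normD _ _) (lexx _)) _.
by move: t1 t2 t3; set X := `| _ |; set Y := `| _ |; set Z := `| _ |; clear; lra.
Qed.

(** Here [W] is a fixed matrix: the randomness enters only through the bounds assumed on it, and [C]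
    depends on [p] and [k] alone. The orthogonal splitting [v = a u + r] reduces everything to
    scalars, and the fourth root [m] makes all exponents integers. *)
Lemma eigenvector_coordinate (R : realType) (p k : R) : 0 < p < 1 -> 1 <= k ->
  exists2 C : R, 0 <= C & forall n (W : 'M[R]_n.+1) (lam : R) (v : 'cV[R]_n.+1)
    (i : 'I_n.+1) (m : R) (e := const_mx 1 : 'cV[R]_n.+1)
    (A := p *: (const_mx 1 - 1%:M) + W),
  m ^+ 4 = n.+1%:R -> 8 * k / p <= m ->
  W^T = W -> (forall i j, `|W i j| <= 1) ->
  largest_eigenvalue A lam -> unit_eigenvector A lam v -> 0 <= \sum_j v j 0 ->
  (forall x, enorm (W *m x) <= k * m ^+ 3 * enorm x) ->
  enorm (W *m e) <= k * m ^+ 4 -> `|dot e (W *m e)| <= k * m ^+ 4 ->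
  `|(W *m e) i 0| <= k * m ^+ 2 -> `|(W *m (W *m e)) i 0| <= k * m ^+ 4 ->
  `|m ^+ 2 * (Num.sqrt lam * v i 0 - Num.sqrt p) - (W *m e) i 0 / m ^+ 2 / Num.sqrt p|
    <= C / m.
Proof.
move=> p01 k1; have /andP[p0 p1] := p01; have k0 : 0 < k by lra.
pose c2 := k + 4 * k ^+ 2 / p.
pose c3 := 2 * (k + 2 * k ^+ 2 / p + k ^+ 2 + 2 * k ^+ 3 / p) / p.
have k20 : 0 <= k ^+ 2 / p by rewrite divr_ge0 ?exprn_ge0 ?ltW.
have k30 : 0 <= k ^+ 3 / p by rewrite divr_ge0 ?exprn_ge0 ?ltW.
have c20 : 0 <= c2 by rewrite /c2; lra.
have c30 : 0 <= c3.
  by rewrite /c3 divr_ge0 ?(ltW p0)//; have := exprn_ge0 2 (ltW k0); lra.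
have [C C0 bound] := eigenvector_scalar_bound p01 (ltW k0) c20 c30.
exists C => // n W lam v i m e A mN hm WT W1 lamA [Av v1] vs hW hWe heWe hWei hWWei.
have m0 : 0 < m by apply: lt_le_trans hm; rewrite divr_gt0// mulr_gt0.
have mn0 : m != 0 by rewrite gt_eqF.
have [u uE] : exists u : 'cV[R]_n.+1, u = (m ^+ 2)^-1 *: e by eexists.
have ee : dot e e = m ^+ 4.
  rewrite mN /dot; under eq_bigr do rewrite mxE mulr1.
  by rewrite sumr_const card_ord.
have uu : dot u u = 1 by rewrite uE dotZl dotZr ee; field.
have vv : dot v v = 1 by rewrite -[RHS]v1; apply: eq_bigr => j _; rewrite expr2.
have AT : A^T = A by rewrite /A linearD/= linearZ/= linearB/= tr_scalar_mx trmx_const WT.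
have Ax x : A *m x = (p * m ^+ 4 * dot u x) *: u - p *: x + W *m x.
  rewrite /A mulmxDl -scalemxAl mulmxBl mul1mx scalerBr; congr (_ - _ + _).
  have -> : const_mx 1 *m x = dot e x *: e :> 'cV[R]_n.+1.
    apply/colP => j; rewrite !mxE mulr1; apply: eq_bigr => l _; by rewrite !mxE.
  by rewrite uE dotZl !scalerA; congr (_ *: _); field.
pose L := lam + p; pose a := dot u v.
have [g gdef] : exists g, g = W *m u by eexists.
have [r rE] : exists r : 'cV[R]_n.+1, r = v - a *: u by eexists.
have addE (x y : 'cV[R]_n.+1) j : (x + y) j 0 = x j 0 + y j 0 by rewrite mxE.
have oppE (x : 'cV[R]_n.+1) j : (- x) j 0 = - x j 0 by rewrite mxE.
have scaleE c (x : 'cV[R]_n.+1) j : (c *: x) j 0 = c * x j 0 by rewrite mxE.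
have gE : g = (m ^+ 2)^-1 *: (W *m e) by rewrite gdef uE -scalemxAr.
have m2V : `|(m ^+ 2)^-1| = (m ^+ 2)^-1 by rewrite ger0_norm// invr_ge0 exprn_ge0// ltW.
have Lv : L *: v = (p * m ^+ 4 * a) *: u + W *m v.
  by rewrite /L scalerDl -Av Ax -/a addrAC subrK.
have ug : dot u g = dot e (W *m e) / m ^+ 4.
  by rewrite gE uE dotZl dotZr; field.
(* The sign convention enters here: the entries of [v] sum to [m^2 * a]. *)
have a0 : 0 <= a.
  rewrite /a uE dotZl mulr_ge0 ?invr_ge0 ?exprn_ge0 ?(ltW m0)//.
  by rewrite /dot; under eq_bigr do rewrite mxE mul1r.
have ur : dot u r = 0 by rewrite rE dotDr dotNr dotZr uu mulr1 subrr.
have rr : dot r r = 1 - a ^+ 2.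
  rewrite {1}rE dotDl dotNl dotZl ur mulr0 subr0 rE dotDr dotNr dotZr vv (dotC v u) -/a; ring.
have Wv : W *m v = a *: g + W *m r.
  by rewrite gdef scalemxAr -mulmxDr rE addrC subrK.
have gW x : dot u (W *m x) = dot g x by rewrite dot_mulmx// gdef.
have gv : dot g v = a * dot u g + dot g r.
  by rewrite -gW Wv dotDr dotZr gW.
have La : L * a = p * m ^+ 4 * a + dot g v.
  by rewrite /a -dotZr Lv dotDr dotZr uu mulr1 gW.
have Lr : L *: r = a *: g + W *m r - dot g v *: u.
  rewrite rE scalerBr Lv [L *: (a *: u)]scalerA La scalerDl -rE -Wv.
  by rewrite opprD addrACA subrr add0r.
have rho2 : enorm r ^+ 2 = 1 - a ^+ 2 by rewrite enormE.
have nu : enorm u = 1 by rewrite /enorm uu sqrtr1.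
have ng : enorm g <= k * m ^+ 2.
  rewrite gE enormZ m2V mulrC ler_pdivrMr ?exprn_gt0//.
  by rewrite -mulrA -exprD.
have hgr : `|dot g r| <= k * m ^+ 2 * enorm r.
  by apply: le_trans (cauchy_schwarz _ _) _; rewrite ler_wpM2r// enorm_ge0.
have hrWr : `|dot r (W *m r)| <= k * m ^+ 3 * enorm r ^+ 2.
  apply: le_trans (cauchy_schwarz _ _) _; rewrite expr2 mulrA [leRHS]mulrC.
  by rewrite ler_wpM2l// enorm_ge0.
have a1 : a <= 1.
  apply: le_trans (ler_norm _) _; apply: le_trans (cauchy_schwarz _ _) _.
  by rewrite nu mul1r /enorm vv sqrtr1.
have hug : `|dot u g| <= k.
  rewrite ug normrM normfV (ger0_norm (exprn_ge0 4 (ltW m0))).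
  by rewrite ler_pdivrMr ?exprn_gt0.
(* The maximality of [lam] enters here, through the Rayleigh quotient at [u]. *)
have L1 : p * m ^+ 4 - k <= L.
  have := rayleigh_le AT lamA u; rewrite Ax uu !mulr1 !(dotDr, dotNr, dotZr) uu -gdef.
  by move: hug; rewrite ler_norml /L => /andP[]; lra.
have L2 : L <= p * m ^+ 4 * a ^+ 2 + k * m ^+ 3.
  have : L = p * m ^+ 4 * a ^+ 2 + dot v (W *m v).
    by rewrite -[LHS]mulr1 -vv -dotZr Lv dotDr dotZr (dotC v) -/a; ring.
  have := cauchy_schwarz v (W *m v); have := hW v.
  rewrite {2 3}/enorm vv sqrtr1 mulr1 mul1r.
  by have := ler_norm (dot v (W *m v)); lra.
have Lrr : L * enorm r ^+ 2 <= k * m ^+ 2 * enorm r + k * m ^+ 3 * enorm r ^+ 2.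
  rewrite enormE -dotZr Lr !(dotDr, dotNr, dotZr) (dotC r u) ur mulr0 subr0.
  rewrite -enormE lerD//; last exact: le_trans (ler_norm _) hrWr.
  apply: le_trans hgr; apply: le_trans (ler_norm _) _.
  by rewrite normrM (ger0_norm a0) dotC ler_piMl.
have La' : (L - p * m ^+ 4) * a = a * dot u g + dot g r.
  by rewrite mulrBl La gv; ring.
have ui : u i 0 = (m ^+ 2)^-1 by rewrite uE !mxE mulr1.
(* The second use of the eigenvalue equation: [W] is applied to the identity [Lr] and coordinate [i]
   is read off. *)
have Ls : L * (W *m r) i 0 = a * (W *m g) i 0 + (W *m (W *m r)) i 0
    - (a * dot u g + dot g r) * g i 0.
  have -> : L * (W *m r) i 0 = (W *m (L *: r)) i 0 by rewrite -scalemxAr scaleE.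
  rewrite Lr gv mulmxBr mulmxDr -!scalemxAr -gdef.
  by rewrite !(addE, oppE, scaleE).
have hwg : `|(W *m g) i 0| <= k * m ^+ 2.
  rewrite gE -scalemxAr scaleE normrM m2V mulrC ler_pdivrMr ?exprn_gt0//.
  by rewrite -mulrA -exprD.
have hgi : `|g i 0| <= k.
  by rewrite gE scaleE normrM m2V mulrC ler_pdivrMr ?exprn_gt0.
have hwwr : `|(W *m (W *m r)) i 0| <= m ^+ 2 * (k * m ^+ 3 * enorm r).
  have -> : (W *m (W *m r)) i 0 = dot (row i W)^T (W *m r).
    by rewrite mxE; apply: eq_bigr => l _; rewrite [in RHS]mxE [in RHS]mxE.
  apply: le_trans (cauchy_schwarz _ _) _; apply: ler_pM; rewrite ?enorm_ge0//.
  rewrite -(@ler_pXn2r _ 2)// ?nnegrE ?enorm_ge0 ?exprn_ge0 ?(ltW m0)//.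
  rewrite enormE -exprM mN -[n.+1 in leRHS]card_ord -sumr_const.
  apply: ler_sum => l _; rewrite !mxE -expr2 -real_normK ?num_real//.
  by rewrite expr_le1// W1.
have Lvi : L * v i 0 = p * m ^+ 2 * a + a * g i 0 + (W *m r) i 0.
  have := congr1 (fun x : 'cV_n.+1 => x i 0) Lv; rewrite Wv !(addE, scaleE) => ->.
  by rewrite ui addrA; congr (_ + _ + _); field.
have [m8 Lh _ hrho [hLp hs]] := eigenvector_scalar_estimates p01 k1 hm L1 L2 a0
  (enorm_ge0 r) rho2 Lrr La' hug hgr Ls hwg hwwr hgi.
have a01 : 0 <= a <= 1 by rewrite a0.
have := bound m L a (enorm r) (g i 0) _ _ m8 Lh a01 (enorm_ge0 r) rho2 hrho hLp hs hgi Lvi.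
have -> : L - p = lam by rewrite /L addrK.
by rewrite [in X in X -> _]gE scaleE [(m ^+ 2)^-1 * _]mulrC.
Qed.

(** * Probability that the expansion applies *)

Lemma summand5_le (R : realType) (a b c d f K : R) :
  0 <= a -> 0 <= b -> 0 <= c -> 0 <= d -> 0 <= f -> a + b + c + d + f <= K ->
  [/\ a <= K, b <= K, c <= K, d <= K & f <= K].
Proof. by move=> *; split; lra. Qed.

Section deviation.
Context {R : realType} (p : R) {n : nat}.
Implicit Types (A : {set 'I_n.+1 * 'I_n.+1}) (i : 'I_n.+1).
Let N : R := n.+1%:R.
Local Notation W := (centered p).
Local Notation e := (const_mx 1 : 'cV[R]_n.+1).

(* Each summand is normalized to have bounded expectation, and together they
   bound everything that [eigenvector_coordinate] needs to know about [W]. *)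
Definition deviation A i : R :=
  N^-1 ^+ 3 * (\sum_j \sum_k (\sum_l W A j l * W A l k) ^+ 2) +
  N^-1 ^+ 2 * (\sum_j (\sum_k W A j k) ^+ 2) +
  N^-1 ^+ 2 * (\sum_j \sum_k W A j k) ^+ 2 +
  N^-1 * (\sum_j W A i j) ^+ 2 +
  N^-1 ^+ 2 * (\sum_j \sum_k W A i j * W A j k) ^+ 2.

Lemma deviation_ge0 A i : 0 <= deviation A i.
Proof.
have N0 : 0 <= N^-1 by rewrite invr_ge0.
rewrite /deviation; do 4?apply: addr_ge0.
all: apply: mulr_ge0; rewrite ?sqr_ge0 ?exprn_ge0//.
all: by do ?[apply: sumr_ge0 => ? _; rewrite ?sqr_ge0//].
Qed.

Lemma expect_deviation i : 0 <= p <= 1 ->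
  expect p upper_pairs (fun A => deviation A i) <= 8.
Proof.
move=> p01; have N0 : 0 < N by rewrite ltr0n.
have Nn0 : N != 0 by rewrite gt_eqF.
rewrite /deviation !expectD !expectZ.
have H c q (x : R) : x <= c * N ^+ q -> N^-1 ^+ q * x <= c.
  by rewrite [N^-1 ^+ q * x]mulrC exprVn ler_pdivrMr ?exprn_gt0.
have h1 := H _ _ _ (expect_square_frobenius p01).
have h2 : N^-1 ^+ 2 * expect p upper_pairs (fun A => \sum_j (\sum_k W A j k) ^+ 2) <= 1.
  apply: H; rewrite expect_sum mul1r (_ : N ^+ 2 = \sum_(j < n.+1) N); last first.
    by rewrite sum_cst_ord expr2.
  apply: ler_sum => j _; exact: expect_row_sum_sqr.
have h3 := H _ _ _ (expect_sum_sqr p01).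
have h4 : N^-1 * expect p upper_pairs (fun A => (\sum_j W A i j) ^+ 2) <= 1.
  by rewrite mulrC ler_pdivrMr// mul1r expect_row_sum_sqr.
have h5 := H _ _ _ (expect_square_row_sqr p01 i).
rewrite (_ : 8 = 2 + 1 + 2 + 1 + 2); last by ring.
by rewrite !lerD.
Qed.

Lemma centered_trmx A : (W A)^T = W A.
Proof. by apply/matrixP => i j; rewrite mxE centeredC. Qed.

End deviation.

(** The summands of [deviation] are nonnegative, so each is at most [k^2]; taking roots gives the
    bounds on [W] with the single constant [k]. *)
Lemma eigenvector_approximation (R : realType) (p k : R) : 0 < p < 1 -> 1 <= k ->
  exists2 C : R, 0 <= C & forall n (A : {set 'I_n.+1 * 'I_n.+1}) i lam
    (v : 'cV[R]_n.+1) (M := p *: (const_mx 1 - 1%:M) + centered p A),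
  deviation p A i <= k ^+ 2 -> 8 * k / p <= Num.sqrt (Num.sqrt n.+1%:R) ->
  largest_eigenvalue M lam -> unit_eigenvector M lam v -> 0 <= \sum_j v j 0 ->
  `|Num.sqrt n.+1%:R * (Num.sqrt lam * v i 0 - Num.sqrt p)
    - scaled_row_sum p A i / Num.sqrt p| <= C / Num.sqrt (Num.sqrt n.+1%:R).
Proof.
move=> p01 k1; have [C C0 bound] := eigenvector_coordinate p01 k1; exists C => //.
move=> n A i lam v M dev hm lamM vM vs; set N : R := n.+1%:R.
have k0 : 0 <= k by lra.
have p01' : 0 <= p <= 1 by case/andP: p01 => *; rewrite !ltW.
set m := Num.sqrt (Num.sqrt N).
have N0 : 0 < N by rewrite ltr0n.
have m2 : m ^+ 2 = Num.sqrt N by rewrite sqr_sqrtr// sqrtr_ge0.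
have m4 : m ^+ 4 = N by rewrite (exprM m 2 2) m2 sqr_sqrtr// ltW.
have m0 : 0 <= m by rewrite sqrtr_ge0.
have NV : 0 <= N^-1 by rewrite invr_ge0 ltW.
pose e := const_mx 1 : 'cV[R]_n.+1.
have We j : (centered p A *m e) j 0 = \sum_k centered p A j k.
  by rewrite mxE; apply: eq_bigr => l _; rewrite [X in _ * X]mxE mulr1.
have t1 : 0 <= N^-1 ^+ 3 * (\sum_j \sum_k (\sum_l centered p A j l * centered p A l k) ^+ 2).
  by rewrite mulr_ge0 ?exprn_ge0//; do 2![apply: sumr_ge0 => ? _]; rewrite sqr_ge0.
have t2 : 0 <= N^-1 ^+ 2 * (\sum_j (\sum_k centered p A j k) ^+ 2).
  by rewrite mulr_ge0 ?exprn_ge0//; apply: sumr_ge0 => ? _; rewrite sqr_ge0.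
have t3 : 0 <= N^-1 ^+ 2 * (\sum_j \sum_k centered p A j k) ^+ 2.
  by apply: mulr_ge0; [exact: exprn_ge0|exact: sqr_ge0].
have t4 : 0 <= N^-1 * (\sum_j centered p A i j) ^+ 2 by rewrite mulr_ge0 ?sqr_ge0.
have t5 : 0 <= N^-1 ^+ 2 * (\sum_j \sum_k centered p A i j * centered p A j k) ^+ 2.
  by apply: mulr_ge0; [exact: exprn_ge0|exact: sqr_ge0].
have H q x : N^-1 ^+ q * x <= k ^+ 2 -> x <= k ^+ 2 * N ^+ q.
  by rewrite mulrC exprVn ler_pdivrMr ?exprn_gt0.
have S q x : 0 <= q -> x ^+ 2 <= k ^+ 2 * q ^+ 2 -> `|x| <= k * q.
  move=> q0; rewrite -exprMn -(real_normK (num_real x)) ler_pXn2r ?nnegrE//.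
  exact: mulr_ge0.
have [d1 d2 d3 d4 d5] := summand5_le t1 t2 t3 t4 t5 dev.
have h1 : \sum_j \sum_k (\sum_l centered p A j l * centered p A l k) ^+ 2 <= k ^+ 2 * N ^+ 3.
  exact: H d1.
have h2 : \sum_j (\sum_k centered p A j k) ^+ 2 <= k ^+ 2 * N ^+ 2.
  exact: H d2.
have h3 : (\sum_j \sum_k centered p A j k) ^+ 2 <= k ^+ 2 * N ^+ 2.
  exact: H d3.
have h4 : (\sum_j centered p A i j) ^+ 2 <= k ^+ 2 * N ^+ 1.
  by apply: H; rewrite expr1.
have h5 : (\sum_j \sum_k centered p A i j * centered p A j k) ^+ 2 <= k ^+ 2 * N ^+ 2.
  exact: H d5.
have := bound n (centered p A) lam v i m m4 hm (centered_trmx p A)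
  (centered_le1 p01' A) lamM vM vs.
rewrite We m2 /scaled_row_sum [_^-1 * _]mulrC; apply; rewrite ?m4.
- move=> x; rewrite -(@ler_pXn2r _ 4)// ?nnegrE ?enorm_ge0//; last first.
    by rewrite !mulr_ge0 ?exprn_ge0 ?enorm_ge0.
  apply: le_trans (enorm_mulmx_frobenius x (centered_trmx p A)) _.
  rewrite exprMn ler_wpM2r ?exprn_ge0 ?enorm_ge0// exprMn -exprM mulnC exprM m4.
  have -> : \sum_i0 \sum_k0 (centered p A *m centered p A) i0 k0 ^+ 2 =
      \sum_j \sum_k (\sum_l centered p A j l * centered p A l k) ^+ 2.
    by apply: eq_bigr => j _; apply: eq_bigr => l _; rewrite mxE.
  (* The fourth power of the norm bound allows [k^4]; the Frobenius sum only costs [k^2], and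
     [k >= 1]. *)
  apply: le_trans h1 _; rewrite ler_wpM2r ?exprn_ge0 ?(ltW N0)//.
  by rewrite ler_weXn2l.
- have := enorm_ge0 (centered p A *m e) => e0; rewrite -[X in X <= _]ger0_norm//.
  apply: S; first exact: ltW.
  rewrite enormE; apply: le_trans h2; rewrite le_eqVlt; apply/orP; left; apply/eqP.
  by apply: eq_bigr => j _; rewrite We expr2.
- apply: S; first exact: ltW.
  rewrite (_ : dot _ _ = \sum_j \sum_k centered p A j k)//.
  by apply: eq_bigr => j _; rewrite We mxE mul1r.
- by apply: S; rewrite ?sqrtr_ge0// sqr_sqrtr ?(ltW N0).
- apply: S; first exact: ltW.
  rewrite (_ : (centered p A *m (centered p A *m e)) i 0 =
    \sum_j \sum_k centered p A i j * centered p A j k)//.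
  by rewrite mxE; apply: eq_bigr => j _; rewrite We mulr_sumr.
Qed.

(** * The random graph as a random subset *)

Section edge_set.
Context (d : measure_display) (T : measurableType d) (R : realType)
  (P : probability T R) (p : R) (n : nat) (E : 'I_n -> 'I_n -> {RV P >-> bool}).

Definition edge_set (w : T) : {set 'I_n * 'I_n} :=
  [set ij : 'I_n * 'I_n | (ij.1 < ij.2)%N && E ij.1 ij.2 w].

Hypothesis hE : erdos_renyi p E.
Lemma edge_set_sub w : edge_set w \subset upper_pairs.
Proof. by apply/fintype.subsetP => ij; rewrite !inE => /andP[]. Qed.

Lemma adjacency_matrixE w :
  adjacency_matrix E w = p *: (const_mx 1 - 1%:M) + centered p (edge_set w).
Proof.
have [E0 EC _ _] := hE; apply/matrixP => i j; rewrite !mxE.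
have [->|ij] := eqVneq i j; first by rewrite E0 subrr mulr0 addr0.
rewrite subr0 mulr1 addrC subrK; congr (_%:R); congr nat_of_bool.
rewrite /edge_key; case: ltnP => [lt_ij|ji]; rewrite inE /= ?lt_ij//.
have -> : (j < i)%N by move: ij; rewrite -(inj_eq val_inj)/=; lia.
by rewrite EC.
Qed.

Local Open Scope classical_set_scope.

Lemma edge_set_fiber (A : {set 'I_n * 'I_n}) : A \subset upper_pairs ->
  [set w | edge_set w = A] =
  [set w | forall k, k \in upper_pairs -> [set k \in A] (E k.1 k.2 w)].
Proof.
move=> AD; apply/seteqP; split => w /=.
  by move=> <- k kD; move: (kD); rewrite !inE => ->.
move=> H; apply/setP => k; rewrite inE.
have [kD|kD] := boolP (k \in upper_pairs).
  by rewrite -(H k kD); move: kD; rewrite inE => ->.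
have -> : (k \in A) = false by apply/negP => /(fintype.subsetP AD); exact/negP.
by move: kD; rewrite inE => /negbTE ->.
Qed.

Lemma measurable_edge_set_eq A : measurable [set w | edge_set w = A].
Proof.
have [AD|AD] := boolP (A \subset upper_pairs); last first.
  rewrite (_ : [set w | _] = set0)//; apply/seteqP; split => // w /= wA.
  by move: AD; rewrite -wA edge_set_sub.
rewrite edge_set_fiber//.
rewrite (_ : [set w | _] = \bigcap_(k in [set` upper_pairs]) (E k.1 k.2 @^-1` [set k \in A])).
  apply: fin_bigcap_measurable; first exact: finite_finset.
  by move=> k _; rewrite -[X in measurable X]setTI; exact: measurable_funPT.
by apply/seteqP; split => w /= H k kD; exact: H.
Qed.

Hypothesis p01 : 0 <= p <= 1.

Lemma prob_edge_set_eq (A : {set 'I_n * 'I_n}) : A \subset upper_pairs ->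
  P [set w | edge_set w = A] = (subset_weight p upper_pairs A)%:E.
Proof.
move=> AD; have [_ _ Eb Ei] := hE; rewrite edge_set_fiber//.
rewrite (Ei upper_pairs (fun k => [set k \in A]))//; last by move=> k; rewrite !inE.
rewrite /subset_weight -prodEFin; apply: eq_bigr => k kD.
have -> : P ((fun w => E k.1 k.2 w) @^-1` [set k \in A]) = bernoulli_prob p [set k \in A].
  have kD' : (k.1 < k.2)%N by move: kD; rewrite inE.
  by rewrite -(Eb _ _ kD').
rewrite bernoulli_probE// !diracE.
case: (k \in A).
  by rewrite (mem_set (_ : [set true] true))//
    (memNset (_ : ~ [set true] false))// mule1 mule0 adde0.
by rewrite (memNset (_ : ~ [set false] true))//
  (mem_set (_ : [set false] false))// mule1 mule0 add0e.
Qed.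

(** An event determined by the graph is a finite disjoint union of fibers of [edge_set]. This
    carries the finite computations over to the given probability space. *)
Lemma prob_edge_set (B : pred {set 'I_n * 'I_n}) :
  measurable [set w | B (edge_set w)] /\
  P [set w | B (edge_set w)] = (expect p upper_pairs (fun A => (B A)%:R))%:E.
Proof.
have -> : [set w | B (edge_set w)] =
    \bigcup_(A in [set` [pred A | (A \in powerset upper_pairs) && B A]])
      [set w | edge_set w = A].
  apply/seteqP; split => w /=.
    by move=> Bw; exists (edge_set w) => //=; rewrite inE inE edge_set_sub.
  by move=> [A /=]; rewrite inE => /andP[_ BA] ->.
split.
  apply: fin_bigcup_measurable; first exact: finite_finpred.
  by move=> A _; exact: measurable_edge_set_eq.
rewrite measure_fin_bigcup//; first last.
- by move=> A _; exact: measurable_edge_set_eq.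
- by move=> A A' _ _ [w [/= <- <-]].
rewrite -(bigfs _ (index_enum_uniq _)); last by move=> A _; rewrite mem_index_enum.
rewrite /expect -sumEFin (eq_bigr (fun A => (subset_weight p upper_pairs A)%:E)).
  rewrite [LHS]big_mkcondr/=; apply: eq_bigr => A _.
  by case: (B A); rewrite ?mul1r ?mul0r.
by move=> A /=; rewrite inE => /andP[AD _]; exact: prob_edge_set_eq.
Qed.

End edge_set.

(** * Convergence in law *)

Local Open Scope classical_set_scope.
Local Open Scope ring_scope.

Lemma normal_prob_ray (R : realType) (s x : R) : 0 < s ->
  normal_prob 0 s `]-oo, x] = (gauss_cdf (x / s))%:E.
Proof.
by move=> s0; rewrite -normal_cdf_scale// /normal_cdf fineK// fin_num_measure.
Qed.

Lemma near_le_sqrt_sqrt (R : realType) (b : R) :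
  \forall n \near \oo, b <= Num.sqrt (Num.sqrt n.+1%:R).
Proof.
have : \forall n \near \oo, b ^+ 4 <= n%:R by exact: nbhs_infty_ger.
apply: filterS => n bn; apply: le_trans (ler_norm b) _.
rewrite -sqrtr_sqr ler_wsqrtr// -[leLHS]ger0_norm ?sqr_ge0// -sqrtr_sqr.
by rewrite ler_wsqrtr// -exprM (le_trans bn)// ler_nat.
Qed.

Lemma measurable_bool_natr (R : realType) :
  measurable_fun setT (fun b : bool => b%:R : R).
Proof. by []. Qed.

(** This makes [lambda] a polynomial in measurable entries, whence its measurability. *)
Lemma unit_eigenvector_form (R : realType) n (A : 'M[R]_n) (a : R) v :
  unit_eigenvector A a v -> a = \sum_i \sum_j A i j * v j 0 * v i 0.
Proof.
move=> [Av v1]; rewrite -[LHS]mulr1 -v1 mulr_sumr; apply: eq_bigr => i _.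
have := congr1 (fun u : 'cV_n => u i 0) Av; rewrite !mxE expr2 mulrA => <-.
by rewrite mulr_suml.
Qed.

Section law.
Context (R : realType) (p : R) (d : measure_display) (T : measurableType d)
  (P : probability T R) (n : nat) (E : 'I_n.+1 -> 'I_n.+1 -> {RV P >-> bool})
  (lambda : T -> R) (V : T -> 'cV[R]_n.+1) (i : 'I_n.+1).
Hypothesis (p01 : 0 < p < 1) (hE : erdos_renyi p E).
Hypothesis hV : forall w, unit_eigenvector (adjacency_matrix E w) (lambda w) (V w).
Hypothesis hVmeas : forall j, measurable_fun setT (fun w => V w j 0).

Let Y w : R := Num.sqrt n.+1%:R * (Num.sqrt (lambda w) * V w i 0 - Num.sqrt p).

Lemma measurable_scaled_error : measurable_fun setT Y.
Proof.
apply: measurable_funM => //; apply: measurable_funB => //; apply: measurable_funM => //.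
have msqrt : measurable_fun setT (Num.sqrt : R -> R).
  by apply: continuous_measurable_fun; exact: sqrt_continuous.
apply: (measurableT_comp msqrt).
rewrite (_ : lambda = fun w => \sum_j \sum_k ((E j k w)%:R * V w k 0 * V w j 0)); last first.
  apply/funext => w; rewrite (unit_eigenvector_form (hV w)).
  by apply: eq_bigr => j _; apply: eq_bigr => k _; rewrite mxE.
apply: measurable_sum => j; apply: measurable_sum => k.
apply: measurable_funM => //; apply: measurable_funM => //.
by apply: (measurableT_comp (@measurable_bool_natr R)).
Qed.

Let p01' : 0 <= p <= 1. Proof. by case/andP: p01 => *; rewrite !ltW. Qed.

(** The eigenvector is chosen at each outcome, not at each graph, so the event [Y <= x] need not be
    determined by the edge set. It is enclosed between two events that are: off the bad set, [Y] is
    within [delta] of a function of the graph, and the bad set has probability at most [8 / k^2] by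
    Markov's inequality. *)
Lemma scaled_error_law_bounds (k delta x : R) : 0 < k ->
  (forall w, deviation p (edge_set E w) i <= k ^+ 2 ->
    `|Y w - scaled_row_sum p (edge_set E w) i / Num.sqrt p| <= delta) ->
  expect p upper_pairs (fun A => (scaled_row_sum p A i <= Num.sqrt p * (x - delta))%R%:R)
    - 8 / k ^+ 2 <= fine (P (Y @^-1` `]-oo, x])) <=
  expect p upper_pairs (fun A => (scaled_row_sum p A i <= Num.sqrt p * (x + delta))%R%:R)
    + 8 / k ^+ 2.
Proof.
move=> k0 close; have p0 : 0 < Num.sqrt p by rewrite sqrtr_gt0; case/andP: p01.
have mY : measurable (Y @^-1` `]-oo, x]).
  by rewrite -[X in measurable X]setTI; exact: measurable_scaled_error.
pose bad (A : {set 'I_n.+1 * 'I_n.+1}) := (k ^+ 2 <= deviation p A i)%R.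
have badP : expect p upper_pairs (fun A => (bad A)%:R) <= 8 / k ^+ 2.
  have k20 : 0 < k ^+ 2 by rewrite exprn_gt0.
  apply: le_trans (expect_markov _ p01' (fun A => deviation_ge0 p A i) k20) _.
  by rewrite ler_wpM2r ?invr_ge0 ?(ltW k20)// expect_deviation.
pose S (A : {set 'I_n.+1 * 'I_n.+1}) := scaled_row_sum p A i.
pose up A := bad A || (S A <= Num.sqrt p * (x + delta)).
pose lo A := ~~ bad A && (S A <= Num.sqrt p * (x - delta)).
have [mup Pup] := prob_edge_set hE p01' up.
have [mlo Plo] := prob_edge_set hE p01' lo.
have closeP w : ~~ bad (edge_set E w) -> `|Y w - S (edge_set E w) / Num.sqrt p| <= delta.
  by rewrite -ltNge => /ltW /close.
have SE A y : (S A <= Num.sqrt p * y) = (S A / Num.sqrt p <= y).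
  by rewrite ler_pdivrMr// mulrC.
apply/andP; split.
  have : expect p upper_pairs (fun A => (lo A)%:R) <= fine (P (Y @^-1` `]-oo, x])).
    rewrite -lee_fin -Plo fineK ?fin_num_measure//.
    apply: le_measure; rewrite ?inE// => w /= /andP[/closeP + ].
    by rewrite SE in_itv/= ler_norml => /andP[_]; lra.
  apply: le_trans; rewrite lerBlDr -lerBlDl (le_trans _ badP)// lerBlDl -expectD.
  apply: expect_le => // A; rewrite /lo; case: (bad A) => /=; last by rewrite addr0.
  by rewrite add0r lern1 leq_b1.
have : fine (P (Y @^-1` `]-oo, x])) <= expect p upper_pairs (fun A => (up A)%:R).
  rewrite -lee_fin -Pup fineK ?fin_num_measure//.
  apply: le_measure; rewrite ?inE// => w /=; rewrite in_itv/= => Yx.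
  rewrite /up; case: (boolP (bad _)) => //= /closeP.
  by rewrite SE ler_norml => /andP[+ _]; lra.
move=> /le_trans; apply; rewrite -lerBlDl (le_trans _ badP)// lerBlDl -expectD.
apply: expect_le => // A; rewrite /up; case: (bad A) => /=; last by rewrite addr0.
by rewrite lerDr.
Qed.

End law.

(* Index n carries the graph on the n.+1 vertices 'I_n.+1; [inord i] is the
   vertex i as soon as i <= n. *)
Theorem corollary3p4 (R : realType) (p : R) (d : nat -> measure_display)
    (T : forall n, measurableType (d n)) (P : forall n, probability (T n) R)
    (E : forall n, 'I_n.+1 -> 'I_n.+1 -> {RV P n >-> bool})
    (lambda : forall n, T n -> R) (V : forall n, T n -> 'cV[R]_n.+1) (i : nat)
    (hp : 0 < p < 1)
    (hE : forall n, erdos_renyi p (E n))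
    (hlambda : forall n w,
      largest_eigenvalue (adjacency_matrix (E n) w) (lambda n w))
    (hV : forall n w,
      unit_eigenvector (adjacency_matrix (E n) w) (lambda n w) (V n w))
    (hVsign : forall n w, 0 <= \sum_j V n w j 0)
    (hVmeas : forall n j, measurable_fun setT (fun w => V n w j 0)) :
  let X n w := Num.sqrt (lambda n w) *: V n w in
  cvg_in_law P
    (fun n w => Num.sqrt n.+1%:R * (X n w (inord i) 0 - Num.sqrt p))
    (normal_prob 0 (Num.sqrt (1 - p))).
Proof.
move=> X; have /andP[p0 p1] := hp.
have q0 : 0 < 1 - p by rewrite subr_gt0.
have sp0 : 0 < Num.sqrt p by rewrite sqrtr_gt0.
have sq0 : 0 < Num.sqrt (1 - p) by rewrite sqrtr_gt0.
pose Y n w : R := Num.sqrt n.+1%:R *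
  (Num.sqrt (lambda n w) * V n w (inord i) 0 - Num.sqrt p).
have -> : (fun n w => Num.sqrt n.+1%:R * (X n w (inord i) 0 - Num.sqrt p)) = Y.
  by apply: functional_extensionality_dep => n; apply/funext => w; rewrite /X mxE.
have mY n : measurable_fun setT (Y n) by exact: measurable_scaled_error (hV n) (hVmeas n).
split => // x _.
suff : P n (Y n @^-1` `]-oo, x]) @[n --> \oo] --> (gauss_cdf (x / Num.sqrt (1 - p)))%:E.
  by rewrite -(normal_prob_ray x sq0).
apply: cvg_EFin.
  apply: nearW => n; rewrite fin_num_measure//.
  by rewrite -[X in measurable X]setTI; exact: mY.
apply/cvgrPdist_le => eta eta0 /=.
have eta4 : 0 < eta / 4 by rewrite divr_gt0.
pose G (y : R) := gauss_cdf (Num.sqrt p * (x + y) / Num.sqrt (p * (1 - p))).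
have G0 : G 0 = gauss_cdf (x / Num.sqrt (1 - p)).
  rewrite /G addr0 sqrtrM ?ltW//; congr gauss_cdf; field.
  by rewrite !gt_eqF.
have cG : {for 0, continuous G}.
  apply: continuous_comp; last exact: continuous_gauss_cdf.
  apply: continuousM; last exact: cst_continuous.
  apply: continuousM; first exact: cst_continuous.
  by apply: continuousD; [exact: cst_continuous|exact: cvg_id].
have [dl dl0 [Gp Gm]] : exists2 dl : R, 0 < dl &
    `|G 0 - G dl| <= eta / 4 /\ `|G 0 - G (- dl)| <= eta / 4.
  have [d1 d10 h1] : \forall e \near (0 : R), `|G 0 - G e| <= eta / 4.
    by have /cvgrPdist_le/(_ _ eta4) := cG.
  have d2 : 0 < d1 / 2 by rewrite divr_gt0.
  have d21 : `|d1 / 2| < d1.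
    by rewrite gtr0_norm// ltr_pdivrMr// ltr_pMr// ltr1n.
  exists (d1 / 2); first exact: d2.
  by split; apply: h1; rewrite /= sub0r ?normrN.
(* Since [eta * k >= 32] and [k >= 1], the bad set costs at most [eta / 4]. The constant [C] depends
   on [k], and only then is [n] taken large enough that [C / m <= dl]. *)
pose k := 1 + 32 / eta.
have k1 : 1 <= k by rewrite lerDl divr_ge0 ?ltW.
have k0 : 0 < k by lra.
have bad4 : 8 / k ^+ 2 <= eta / 4.
  rewrite ler_pdivrMr ?exprn_gt0//.
  have : 32 <= eta * k by rewrite mulrDr mulr1 mulrCA divff ?gt_eqF//; lra.
  have : eta * k <= eta * k ^+ 2 by rewrite ler_pM2l// expr2 ler_peMl// ltW.
  by lra.
have [C C0 approx] := eigenvector_approximation hp k1.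
have n1 := near_le_sqrt_sqrt (8 * k / p).
have n2 := near_le_sqrt_sqrt (C / dl + 1).
have n3 := row_sum_clt hp (Num.sqrt p * (x + dl)) eta4.
have n4 := row_sum_clt hp (Num.sqrt p * (x - dl)) eta4.
near=> n.
have hn1 : 8 * k / p <= Num.sqrt (Num.sqrt n.+1%:R) by near: n.
have hn2 : C / dl + 1 <= Num.sqrt (Num.sqrt n.+1%:R) by near: n.
have H3 : `|expect p upper_pairs (fun A => (scaled_row_sum p A (inord i : 'I_n.+1)
    <= Num.sqrt p * (x + dl))%R%:R) - G dl| <= eta / 4.
  (* The type of the vertex depends on [n]; the uniformity over vertices in [row_sum_clt] allows
     generalizing it. *)
  by move: (inord i); near: n.
have H4 : `|expect p upper_pairs (fun A => (scaled_row_sum p A (inord i : 'I_n.+1)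
    <= Num.sqrt p * (x - dl))%R%:R) - G (- dl)| <= eta / 4.
  by move: (inord i); near: n.
have close w : deviation p (edge_set (E n) w) (inord i) <= k ^+ 2 ->
    `|Y n w - scaled_row_sum p (edge_set (E n) w) (inord i) / Num.sqrt p| <= dl.
  move=> dev; have := hlambda n w; have := hV n w.
  rewrite (adjacency_matrixE (hE n)) => vM lM.
  apply: le_trans (approx n _ _ _ _ dev hn1 lM vM (hVsign n w)) _.
  have m0 : 0 < Num.sqrt (Num.sqrt n.+1%:R) :> R by rewrite !sqrtr_gt0.
  rewrite ler_pdivrMr// mulrC -ler_pdivrMr//; move: hn2; clear; lra.
have /andP[] := scaled_error_law_bounds (i := inord i) hp (hE n) (hV n) (hVmeas n) x k0 close.
rewrite -/(Y n) -G0; move: H3 H4 Gp Gm bad4; clear.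
move: (expect _ _ _) (expect _ _ _) (G dl) (G (- dl)) (G 0) (8 / _) (fine _).
by move=> a b c f g h l; rewrite !ler_norml; do 4!move=> /andP[? ?]; move=> *;
  apply/andP; split; lra.
Unshelve. all: by end_near.
Qed.
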